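(* Let $F$ be a field of characteristic $0$ and let $d,m$ be positive integers with $m\le 2d$. Then $ST(m^{[d;m]}\oplus(m-1))$ is NOT a tensor polynomial identity for $d\times d$ matrices $M_d(F)$ if and only if either $m$ is even, or $m$ is odd and $m\le d$.
   Context: $[d;m]:=\sum_{i=1}^d\lfloor(2i-1)/m\rfloor$. $m^r$ is the partition with $r$ parts equal to $m$; $\lambda\oplus\mu$ is the partition with the parts of $\lambda$ and $\mu$ arranged non-increasingly (a part $0$ is omitted). For a partition $\lambda=(h_1,\dots,h_n)\vdash k$, $ST(\lambda)(x_1,\dots,x_k):=\sum_{\tau\in S_k}\epsilon_\tau(X_1\otimes\cdots\otimes X_n)(x_{\tau(1)},\dots,x_{\tau(k)})\in F\langle X\rangle^{\otimes n}$ with $X_j:=x_{h_1+\dots+h_{j-1}+1}\cdots x_{h_1+\dots+h_j}$, $F\langle X\rangle$ the free associative algebra. A tensor polynomial identity for $M_d(F)$ is a tensor polynomial vanishing under every evaluation $x_i\mapsto A_i\in M_d(F)$. *)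

(* Defs.v *)
From mathcomp Require Import all_boot all_order all_fingroup all_algebra.
Set Implicit Arguments. Unset Strict Implicit. Unset Printing Implicit Defensive.
Import GRing.Theory.
Local Open Scope ring_scope.

Definition bracket (d m : nat) : nat :=
  (\sum_(1 <= i < d.+1) (2 * i - 1) %/ m)%N.

Definition ppow (m r : nat) : seq nat := nseq r m.

Definition poplus (l1 l2 : seq nat) : seq nat :=
  sort (fun a b : nat => (b <= a)%N) [seq x <- l1 ++ l2 | (0 < x)%N].

Definition permn (k : nat) (t : 'S_k) (i : nat) : nat :=
  if insub i is Some o then val (t o) else i.

(* X_j evaluated at (x_{t(1)},...,x_{t(k)}) with x_i |-> A i (0-based positions):
   the ordered product A(t(s+1)) ... A(t(s+h_j)), s = h_1+...+h_{j-1} *)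
Definition block_eval (F : fieldType) (d : nat) (lam : seq nat)
    (t : 'S_(sumn lam)) (A : nat -> 'M[F]_d) (j : nat) : 'M[F]_d :=
  \big[@mulmx F d d d / 1%:M]_(sumn (take j lam) <= i < sumn (take j.+1 lam))
     A (permn t i).

(* The evaluation of ST(lam) at x_i |-> A i, as an element of M_d(F)^{(x) n},
   n = size lam, written in coordinates w.r.t. the standard basis
   E_{i1 j1} (x) ... (x) E_{in jn}: the coordinate of
   (B_1 (x) ... (x) B_n) at e is prod_j (B_j) (e j).1 (e j).2. *)
Definition ST_eval (F : fieldType) (d : nat) (lam : seq nat)
    (A : nat -> 'M[F]_d) (e : 'I_(size lam) -> 'I_d * 'I_d) : F :=
  \sum_(t : 'S_(sumn lam))
     (-1) ^+ (odd_perm t) *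
     \prod_(j < size lam) (block_eval t A j) (e j).1 (e j).2.

Definition is_TPI (F : fieldType) (d : nat) (lam : seq nat) : Prop :=
  forall (A : nat -> 'M[F]_d) (e : 'I_(size lam) -> 'I_d * 'I_d),
    ST_eval A e = 0.

(* Main.v *)
(* Replace the matrices by one generic matrix [X] whose d^2 entries are anticommuting
   generators of a Grassmann algebra over the rationals: ST(lambda) is an identity iff every
   product of one entry from each [X ^+ h_j] vanishes. Such a product is nonzero iff it can be
   completed by entries of [X] to a nonzero multiple of the top form, which gives a rational
   tensor commuting with all [g^{(x) N}]. A tensor of this kind that is orthogonal to all
   permutations is zero, by a positivity argument. Contracting with a permutation merges the
   parts of lambda along its cycles into a product of traces [tr X^c]; these vanish for [c]
   even or [c > 2 d] (Amitsur-Levitzki) and square to zero, so a nonzero product of total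
   degree d^2 is that of [tr X^1, tr X^3, ..., tr X^(2d-1)]. Hence ST(lambda) is not an identity iff
   the parts of lambda can be packed into bins of sizes 1, 3, ..., 2d-1. For the partition at
   hand the parts [m] fill every bin, so one bin must leave room [m - 1], i.e. m must
   divide 2i for some 1 <= i <= d. *)
Require Import Defs.
From HB Require Import structures.
From mathcomp Require Import all_boot all_order all_fingroup all_algebra.
From mathcomp Require Import zify.
Set Implicit Arguments. Unset Strict Implicit. Unset Printing Implicit Defensive.
Import Order.TTheory GRing.Theory Num.Theory.
Local Open Scope ring_scope.

(** * Recursion over permutations and over finite functions *)

Lemma perm_fix0 n (s : 'S_n.+1) :
  s ord0 = ord0 -> exists s' : 'S_n, s = lift_perm ord0 ord0 s'.
Proof.
move=> s0.
have sl i : s (lift ord0 i) != ord0.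
  by rewrite -{2}s0 (inj_eq perm_inj) eq_sym neq_lift.
have ex i : exists j, s (lift ord0 i) == lift ord0 j.
  by case: (unliftP ord0 (s (lift ord0 i))) (sl i) => [j ->|->]; [exists j | rewrite eqxx].
pose f i := xchoose (ex i).
have fE i : lift ord0 (f i) = s (lift ord0 i) by rewrite (eqP (xchooseP (ex i))).
have f_inj : injective f.
  move=> i j eq_f; apply: (@lift_inj _ ord0); apply: (@perm_inj _ s).
  by rewrite -!fE eq_f.
exists (perm f_inj); apply/permP=> i.
case: (unliftP ord0 i) => [j ->|->]; last by rewrite lift_perm_id.
by rewrite lift_perm_lift permE fE.
Qed.

(** Induction principle for permutations: if [ord0] is not fixed, precomposing with the
    transposition of [ord0] and its preimage makes it fixed. *)
Lemma perm_recl n (s : 'S_n.+1) :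
  exists s' : 'S_n, s = lift_perm ord0 ord0 s' \/
    exists j, s = (tperm ord0 (lift ord0 j) * lift_perm ord0 ord0 s')%g.
Proof.
case: (unliftP ord0 ((s^-1)%g ord0)) => [j jE|E]; last first.
  have s0 : s ord0 = ord0 by rewrite -{1}E permKV.
  by have [s' ->] := perm_fix0 s0; exists s'; left.
have [s' s'E] : exists s', (tperm ord0 (lift ord0 j) * s)%g = lift_perm ord0 ord0 s'.
  by apply: perm_fix0; rewrite permM tpermL -jE permKV.
by exists s'; right; exists j; rewrite -s'E mulgA tperm2 mul1g.
Qed.

Definition fcons (T : finType) n (x : T) (a : {ffun 'I_n -> T}) : {ffun 'I_n.+1 -> T} :=
  [ffun i => if unlift ord0 i is Some j then a j else x].

Lemma fcons0 (T : finType) n (x : T) (a : {ffun 'I_n -> T}) : fcons x a ord0 = x.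
Proof. by rewrite ffunE unlift_none. Qed.

Lemma fconsS (T : finType) n (x : T) (a : {ffun 'I_n -> T}) j : fcons x a (lift ord0 j) = a j.
Proof. by rewrite ffunE liftK. Qed.

Lemma sum_fcons (V : nmodType) (T : finType) n (F : {ffun 'I_n.+1 -> T} -> V) :
  \sum_a F a = \sum_x \sum_(a : {ffun 'I_n -> T}) F (fcons x a).
Proof.
rewrite pair_big /= (reindex (fun p : T * {ffun 'I_n -> T} => fcons p.1 p.2)) //=.
exists (fun a => (a ord0, [ffun j => a (lift ord0 j)])) => [[x a]|a] _ /=.
  by rewrite fcons0; congr (_, _); apply/ffunP=> j; rewrite ffunE fconsS.
apply/ffunP=> i; case: (unliftP ord0 i) => [j ->|->]; rewrite ?fcons0 //.
by rewrite fconsS ffunE.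
Qed.

(** * Grassmann algebras *)

(* Only what is needed of a rational Grassmann algebra: the generators need not span the ring,
   and [berezin] is any form reading off the coefficient of the ordered top product. *)
Record grassmann (M : nat) := Grassmann {
  gr_ring :> nzRingType;
  gr_scal : rat -> gr_ring;
  gr_gen : 'I_M -> gr_ring;
  berezin : gr_ring -> rat;
  gr_scal_sub : zmod_morphism gr_scal;
  gr_scal_mul : monoid_morphism gr_scal;
  gr_scalC : forall c x, gr_scal c * x = x * gr_scal c;
  gr_anti : forall i j, gr_gen i * gr_gen j = - (gr_gen j * gr_gen i);
  berezin_sub : zmod_morphism berezin;
  berezinZ : forall c x, berezin (gr_scal c * x) = c * berezin x;
  berezin_top : berezin (\prod_i gr_gen i) = 1 }.

HB.instance Definition _ M (G : grassmann M) :=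
  GRing.isZmodMorphism.Build rat (gr_ring G) (@gr_scal M G) (@gr_scal_sub M G).
HB.instance Definition _ M (G : grassmann M) :=
  GRing.isMonoidMorphism.Build rat (gr_ring G) (@gr_scal M G) (@gr_scal_mul M G).
HB.instance Definition _ M (G : grassmann M) :=
  GRing.isZmodMorphism.Build (gr_ring G) rat (@berezin M G) (@berezin_sub M G).

Section Extension.
Variables (M : nat) (G : grassmann M).

Local Notation "''diag'" := (fun x y : G => \matrix_(i < 2, j < 2) (if i == j then (if i == 0 then x else y) else 0) : 'M[G]_2).

Definition ext_scal (c : rat) : 'M[G]_2 := (gr_scal G c)%:M.
(** Adjunction of one generator inside 2 x 2 matrices: the new one is the nilpotent elementary
    matrix at (0, 1), and the opposite sign in the second diagonal entry of the old ones makes them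
    anticommute with it. *)
Definition ext_gen (i : 'I_M.+1) : 'M[G]_2 :=
  if unlift ord_max i is Some j then 'diag (gr_gen G j) (- gr_gen G j) else delta_mx 0 1.
Definition ext_berezin (x : 'M[G]_2) := berezin (x 0 1).

Lemma M2_eqP (A B : 'M[G]_2) :
  A 0 0 = B 0 0 -> A 0 1 = B 0 1 -> A 1 0 = B 1 0 -> A 1 1 = B 1 1 -> A = B.
Proof.
have ord2 (i : 'I_2) : i = 0 \/ i = 1.
  by case: i => [[|[|//]] ?]; [left | right]; apply: val_inj.
by move=> *; apply/matrixP=> i j; case: (ord2 i) => ->; case: (ord2 j) => ->.
Qed.

Lemma M2_mulE (A B : 'M[G]_2) i j : (A * B) i j = A i 0 * B 0 j + A i 1 * B 1 j.
Proof.
rewrite mxE !big_ord_recl big_ord0 addr0.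
by rewrite (_ : lift ord0 ord0 = 1) //; apply: val_inj.
Qed.

Lemma ext_anti i j : ext_gen i * ext_gen j = - (ext_gen j * ext_gen i).
Proof.
rewrite /ext_gen; case: (unlift _ i) => [i'|]; case: (unlift _ j) => [j'|];
  apply: M2_eqP; rewrite !(M2_mulE, mxE) /=;
  rewrite ?(mulr0, mul0r, addr0, add0r, mulNr, mulrN, opprK, oppr0, mulr1, mul1r) //;
  by rewrite gr_anti ?opprK.
Qed.

Lemma ext_top : ext_berezin (\prod_i ext_gen i) = 1.
Proof.
rewrite /ext_berezin big_ord_recr /=.
have -> : \prod_(i < M) ext_gen (widen_ord (leqnSn M) i) = 
   \prod_(i < M) 'diag (gr_gen G i) (- gr_gen G i).
  apply: eq_bigr => i _; rewrite /ext_gen.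
  have -> : widen_ord (leqnSn M) i = lift ord_max i by apply: val_inj; rewrite /= /bump leqNgt ltn_ord.
  by rewrite liftK.
rewrite M2_mulE [ext_gen ord_max]/ext_gen unlift_none !mxE /= mulr0 addr0 mulr1.
suff -> : (\prod_(i < M) 'diag (gr_gen G i) (- gr_gen G i)) 0 0 = \prod_i gr_gen G i.
  exact: berezin_top.
have : (\prod_(i < M) 'diag (gr_gen G i) (- gr_gen G i)) 0 1 = 0 /\
  (\prod_(i < M) 'diag (gr_gen G i) (- gr_gen G i)) 0 0 = \prod_i gr_gen G i.
  apply: (big_rec2 (fun (x : 'M[G]_2) y => x 0 1 = 0 /\ x 0 0 = y)) => [|i y x _ [H1 H2]].
    by rewrite !mxE.
  by rewrite !M2_mulE H1 H2 !mxE /= mulr0 !mul0r !addr0.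
by case.
Qed.

Definition grassmann_ext : grassmann M.+1.
Proof.
refine (@Grassmann M.+1 'M[G]_2 ext_scal ext_gen ext_berezin _ _ _ ext_anti _ _ ext_top).
- by move=> a b; rewrite /ext_scal raddfB /= raddfB.
- by split=> [|a b]; rewrite /ext_scal ?rmorph1 // rmorphM scalar_mxM.
- move=> c x; apply: M2_eqP; rewrite !M2_mulE !mxE /= ?(mul0r, mulr0, addr0, add0r) ?mulr1n ?mulr0n ?(mul0r, mulr0, addr0, add0r);
  exact: gr_scalC.
- by move=> a b; rewrite /ext_berezin !mxE raddfB.
- move=> c x; rewrite /ext_berezin M2_mulE !mxE /= mulr0n mul0r addr0 mulr1n.
  exact: berezinZ.
Defined.

End Extension.

Lemma grassmann_exists M : inhabited (grassmann M).
Proof.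
elim: M => [|M [G]]; last by constructor; exact: grassmann_ext.
constructor; refine (@Grassmann 0 rat id (fun i => 0) id _ _ _ _ _ _ _) => //; last by rewrite big_ord0.
by move=> c x; rewrite mulrC.
Qed.

Lemma signr_mulCA (R : pzRingType) (x y : R) n : x * ((-1) ^+ n * y) = (-1) ^+ n * (x * y).
Proof. by rewrite mulrA commr_sign mulrA. Qed.

Section GrassmannTheory.
Variables (M : nat) (G : grassmann M).
Local Notation xi := (gr_gen G).
Local Notation iota := (gr_scal G).

Lemma gr_torsion (x : G) n : x *+ n.+1 = 0 -> x = 0.
Proof.
move=> x0; rewrite -[x]mul1r -(rmorph1 iota) -(@mulVf _ (n.+1%:R : rat)) ?pnatr_eq0 //.
by rewrite rmorphM -mulrA rmorph_nat mulr_natl x0 mulr0.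
Qed.

Lemma gr_eqN (x : G) : x = - x -> x = 0.
Proof. by move=> xN; apply: (@gr_torsion x 1); rewrite mulr2n {2}xN subrr. Qed.

Lemma berezin_sign n (x : G) : berezin ((-1) ^+ n * x) = (-1) ^+ n * berezin x.
Proof.
rewrite -[in LHS]signr_odd -[in RHS]signr_odd.
by case: (odd n); rewrite ?expr1 ?expr0 ?mulN1r ?mul1r ?raddfN.
Qed.

(** Parity is witnessed by a construction rather than read off a grading: 0 has both parities, and
    nothing is asserted about elements not built from generators and scalars. *)
Inductive homog : bool -> G -> Prop :=
  | homog_gen i : homog true (xi i)
  | homog_scal c : homog false (iota c)
  | homog0 p : homog p 0
  | homogD p x y : homog p x -> homog p y -> homog p (x + y)
  | homogM p q x y : homog p x -> homog q y -> homog (p (+) q) (x * y).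

Lemma homog1 : homog false 1.
Proof. by rewrite -(rmorph1 iota); exact: homog_scal. Qed.

Lemma homog_prod (I : Type) (r : seq I) (p : I -> bool) (F : I -> G) :
  (forall i, homog (p i) (F i)) ->
  homog (\big[addb/false]_(i <- r) p i) (\prod_(i <- r) F i).
Proof.
move=> hF; elim: r => [|i r IH]; first by rewrite !big_nil; exact: homog1.
by rewrite !big_cons; exact: homogM.
Qed.

Lemma homog_sum (I : Type) (r : seq I) p (F : I -> G) :
  (forall i, homog p (F i)) -> homog p (\sum_(i <- r) F i).
Proof.
move=> hF; elim: r => [|i r IH]; first by rewrite !big_nil; exact: homog0.
by rewrite !big_cons; exact: homogD.
Qed.

Lemma gen_supercomm i q y : homog q y -> xi i * y = (-1) ^+ q * (y * xi i).
Proof.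
elim=> {q y} [j|c|p|p x y _ IHx _ IHy|p q x y _ IHx _ IHy].
- by rewrite expr1 mulN1r gr_anti.
- by rewrite expr0 mul1r gr_scalC.
- by rewrite mulr0 mul0r mulr0.
- by rewrite mulrDr IHx IHy mulrDl mulrDr.
- rewrite mulrA IHx -!mulrA IHy signr_addb -!mulrA; congr (_ * _).
  by rewrite signr_mulCA.
Qed.

Lemma supercomm p q x y : homog p x -> homog q y -> x * y = (-1) ^+ (p && q) * (y * x).
Proof.
move=> hx hy; elim: hx q y hy => {p x} [i|c|p|p x x' _ IHx _ IHy|p p' x x' _ IHx _ IHy] q y hy.
- exact: gen_supercomm.
- by rewrite mul1r gr_scalC.
- by rewrite mulr0 mul0r mulr0.
- by rewrite mulrDl (IHx q) // (IHy q) // mulrDr mulrDr.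
- rewrite -mulrA (IHy q) // signr_mulCA [x * (y * _)]mulrA (IHx q) //.
  by rewrite andb_addl signr_addb -!mulrA signr_mulCA.
Qed.

(** The transpositions produced by [perm_recl] are not adjacent. The two exchanged letters each
    cross the same letters in between, so these signs cancel and a single sign remains. *)
Lemma swap_head n (f : 'I_n -> 'I_M) j x y :
  xi x * \prod_(i < n) xi (if i == j then y else f i) =
  - (xi y * \prod_(i < n) xi (if i == j then x else f i)).
Proof.
elim: n f j => [|n IH] f j; first by case: j.
rewrite !big_ord_recl.
case: (unliftP ord0 j) => [j' ->|->].
  have E z : \prod_(i < n) xi (if lift ord0 i == lift ord0 j' then z else f (lift ord0 i)) =
     \prod_(i < n) xi (if i == j' then z else f (lift ord0 i)).
    by apply: eq_bigr => i _; rewrite (inj_eq lift_inj).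
  rewrite !E (negbTE (neq_lift _ _)) mulrA gr_anti mulNr -mulrA IH mulrN opprK !mulrA.
  by rewrite gr_anti mulNr opprK.
by rewrite eqxx !mulrA gr_anti mulNr; congr (- (_ * _)).
Qed.

Lemma gen_word_perm k (w : 'I_k -> 'I_M) (t : 'S_k) :
  \prod_(p < k) xi (w (t p)) = (-1) ^+ t * \prod_(p < k) xi (w p).
Proof.
elim: k w t => [|k IH] w t; first by rewrite !big_ord0 mulr1 (_ : t = 1%g) ?odd_perm1 //;
  apply/permP; case.
have IHl (v : 'I_k.+1 -> 'I_M) (s : 'S_k) : \prod_(p < k.+1) xi (v (lift_perm ord0 ord0 s p)) =
    (-1) ^+ s * \prod_(p < k.+1) xi (v p).
  rewrite !big_ord_recl lift_perm_id -signr_mulCA; congr (_ * _).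
  rewrite -(IH (fun i => v (lift ord0 i))); apply: eq_bigr => i _.
  by rewrite lift_perm_lift.
have [s [->|[j ->]]] := perm_recl t.
  by rewrite IHl odd_lift_perm.
pose v p := w (lift_perm ord0 ord0 s p).
transitivity (\prod_(p < k.+1) xi (v (tperm ord0 (lift ord0 j) p))).
  by apply: eq_bigr => p _; rewrite permM.
rewrite odd_mul_tperm neq_lift odd_lift_perm /= signrN mulNr -IHl -/(v _).
rewrite !big_ord_recl tpermL /=.
transitivity (xi (v (lift ord0 j)) * \prod_(i < k) xi (if i == j then v ord0 else v (lift ord0 i))).
  congr (_ * _); apply: eq_bigr => i _; congr (xi _).
  case: eqP => [->|ne]; first by rewrite tpermR.
  by rewrite tpermD ?neq_lift // (inj_eq lift_inj) eq_sym; apply/eqP.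
rewrite swap_head; congr (- (_ * _)); apply: eq_bigr => i _.
by case: eqP => [->|].
Qed.

(** The transposition of the two positions fixes the word and negates the product. *)
Lemma gen_word_eq0 k (w : 'I_k -> 'I_M) i j :
  i != j -> w i = w j -> \prod_(p < k) xi (w p) = 0.
Proof.
move=> ne eq_w; apply: gr_eqN.
have := gen_word_perm w (tperm i j); rewrite odd_tperm ne mulN1r => <-.
by apply: eq_bigr => p _; case: tpermP => [->|->|] //; rewrite eq_w.
Qed.

End GrassmannTheory.

(** * Traces of the generic matrix *)

Section Traces.
Variables (d : nat) (G : grassmann (d * d)).
Local Notation xi := (gr_gen G).

Definition generic_mx : 'M[G]_d := \matrix_(a, b) xi (mxvec_index a b).
Local Notation X := generic_mx.
Local Notation T c := (\tr (X ^+ c)).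

Lemma mulmx_homog p q (A B : 'M[G]_d) :
  (forall a b, homog p (A a b)) -> (forall a b, homog q (B a b)) ->
  forall a b, homog (p (+) q) ((A * B) a b).
Proof.
move=> hA hB a b; rewrite -mulmxE mxE; apply: homog_sum => c.
exact: homogM.
Qed.

Lemma generic_exp_homog h a b : homog (odd h) ((X ^+ h) a b).
Proof.
elim: h a b => [|h IH] a b.
  by rewrite expr0 mxE; case: (a == b); [exact: homog1 | exact: homog0].
by rewrite exprS oddS -addTb; apply: mulmx_homog => // a' b'; rewrite mxE; exact: homog_gen.
Qed.

Lemma trace_homog c : homog (odd c) (T c).
Proof. by apply: homog_sum => i; exact: generic_exp_homog. Qed.

(** Cyclicity of the trace moves one odd factor [X] past an odd power of [X], at the cost of a
    sign. *)
Lemma trace_even c : ~~ odd c -> (0 < c)%N -> T c = 0.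
Proof.
case: c => // c; rewrite oddS negbK => oc _; apply: gr_eqN.
rewrite {1}exprS exprSr -!mulmxE /mxtrace -sumrN.
under eq_bigr do rewrite mxE.
under [RHS]eq_bigr do rewrite mxE -sumrN.
rewrite exchange_big; apply: eq_bigr => i _; apply: eq_bigr => j _.
rewrite (supercomm (p := true) (q := true)) ?expr1 ?mulN1r //.
  by rewrite mxE; exact: homog_gen.
by rewrite -oc; exact: generic_exp_homog.
Qed.

Lemma trace_sqr c : odd c -> T c * T c = 0.
Proof.
move=> oc; apply: gr_eqN; have := trace_homog c; rewrite oc => hT.
by rewrite {1}(supercomm hT hT) mulN1r.
Qed.

(** Two equal odd traces can be brought together up to sign, where their square vanishes. *)
Lemma trace_prod_uniq (cs : seq nat) :
  \prod_(c <- cs) T c != 0 -> all odd cs -> uniq cs.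
Proof.
move=> nz oc; apply: contraNT nz => /(uniqPn 0%N) [i [j [lt_ij lt_j eq_ij]]]; apply/eqP.
have lt_i := ltn_trans lt_ij lt_j.
rewrite -(cat_take_drop i cs) big_cat /= (drop_nth 0%N) // big_cons.
have lt_j' : (j - i.+1 < size (drop i.+1 cs))%N by rewrite size_drop ltn_sub2r // (leq_ltn_trans lt_ij).
rewrite -(cat_take_drop (j - i.+1) (drop i.+1 cs)) big_cat /= (drop_nth 0%N lt_j') big_cons.
rewrite nth_drop subnKC // -eq_ij.
set c := nth _ _ _; set P := \prod_(_ <- take (j - _) _) _.
have hP := @homog_prod _ _ _ (take (j - i.+1) (drop i.+1 cs)) odd _ trace_homog.
have oc' : odd c by exact: (allP oc _ (mem_nth _ lt_i)).
rewrite [P * _]mulrA (supercomm hP (trace_homog c)) -/P -!mulrA.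
by rewrite (mulrA (T c) ((-1) ^+ _)) commr_sign -!mulrA (mulrA (T c) (T c)) trace_sqr // mul0r !mulr0.
Qed.

(** Full contraction of the tensor product of the [X ^+ h j] with the permutation [s]; for commuting
    entries it would be the product over the cycles of [s] of traces of powers. *)
Definition perm_trace N (h : 'I_N -> nat) (s : 'S_N) : G :=
  \sum_(a : {ffun 'I_N -> 'I_d}) \prod_(j < N) (X ^+ h j) (a j) (a (s j)).

Lemma perm_trace_fix N (h : 'I_N.+1 -> nat) s :
  perm_trace h (lift_perm ord0 ord0 s) = T (h ord0) * perm_trace (fun j => h (lift ord0 j)) s.
Proof.
rewrite /perm_trace sum_fcons /mxtrace big_distrl; apply: eq_bigr => x _.
rewrite big_distrr; apply: eq_bigr => a _ /=.
rewrite big_ord_recl lift_perm_id !fcons0; congr (_ * _); apply: eq_bigr => j _.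
by rewrite lift_perm_lift !fconsS.
Qed.

(** Moving [y x] to the right of slot [j] gives a sign depending on parities alone. Hence [s] is
    chosen before the factors and can be pulled out of every sum. *)
Lemma insert_factor N (p : 'I_N -> bool) (q : bool) (j : 'I_N) :
  exists2 s : bool, ((q -> forall i, p i = false) -> s = false) &
  forall (I : finType) (y F : I -> G) (E : 'I_N -> G),
    (forall x, homog q (y x)) -> (forall x, homog (p j) (F x)) ->
    (forall i, homog (p i) (E i)) ->
    \sum_x y x * \prod_i (if i == j then F x else E i) =
    (-1) ^+ s * \prod_i (if i == j then \sum_x F x * y x else E i).
Proof.
elim: N p j => [|N IH] p j; first by case: j.
case: (unliftP ord0 j) => [j' ->|->].
  have [s s0 IHs] := IH (fun i => p (lift ord0 i)) j'.
  exists ((q && p ord0) (+) s).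
    move=> H; rewrite s0 => [|/H //]; case: q H {IH s0 IHs} => //= -> //.
  move=> I y F E hy hF hE; rewrite big_ord_recl (negbTE (neq_lift ord0 j')).
  have tailE z : \prod_i (if lift ord0 i == lift ord0 j' then z else E (lift ord0 i)) =
      \prod_i (if i == j' then z else E (lift ord0 i)).
    by apply: eq_bigr => i _; rewrite (inj_eq lift_inj).
  under eq_bigr => x _.
    rewrite big_ord_recl (negbTE (neq_lift ord0 j')) mulrA (supercomm (hy x) (hE ord0)) -!mulrA.
    rewrite tailE.
    over.
  by rewrite tailE -big_distrr -big_distrr /= IHs // signr_addb -!mulrA signr_mulCA.
exists (q && p ord0); first by case: q {IH} => // ->.
move=> I y F E hy hF hE; rewrite big_ord_recl /= mulrA big_distrr big_distrl /=.
apply: eq_bigr => x _; rewrite big_ord_recl /= mulrA (supercomm (hy x) (hF x)).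
by rewrite -!mulrA.
Qed.

Definition merge_exp N (h : 'I_N.+1 -> nat) (j i : 'I_N) : nat :=
  if i == j then (h (lift ord0 j) + h ord0)%N else h (lift ord0 i).

Lemma merge_exp_odd N (h : 'I_N.+1 -> nat) j :
  (\sum_i odd (merge_exp h j i) <= \sum_i odd (h i))%N.
Proof.
rewrite big_ord_recl (bigD1 j) //= [X in (_ <= _ + X)%N](bigD1 j) //= addnA.
rewrite {1}/merge_exp eqxx oddD; apply: leq_add; first by case: (odd _); case: (odd _).
by apply: leq_sum => i ne; rewrite /merge_exp (negbTE ne).
Qed.

(** In this permutation slot [ord0] comes right after slot [lift ord0 j] in its cycle; summing over
    the index of [ord0] multiplies the two powers of [X]. *)
Lemma perm_trace_merge N (h : 'I_N.+1 -> nat) j :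
  exists2 s : bool, ((\sum_i odd (h i) <= 1)%N -> s = false) & forall t,
  perm_trace h (tperm ord0 (lift ord0 j) * lift_perm ord0 ord0 t)%g =
  (-1) ^+ s * perm_trace (merge_exp h j) t.
Proof.
have [s s0 IHs] := insert_factor (fun i => odd (h (lift ord0 i))) (odd (h ord0)) j.
exists s.
  rewrite big_ord_recl => le1; apply: s0 => o0 i; move: le1; rewrite o0 (bigD1 i) //=.
  by case: (odd _).
move=> t; rewrite /perm_trace sum_fcons exchange_big big_distrr; apply: eq_bigr => a _.
transitivity (\sum_x (X ^+ h ord0) x (a (t j)) *
   \prod_i (if i == j then (X ^+ h (lift ord0 j)) (a j) x else (X ^+ h (lift ord0 i)) (a i) (a (t i)))).
  apply: eq_bigr => x _; rewrite big_ord_recl fcons0 permM tpermL lift_perm_lift fconsS.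
  congr (_ * _); apply: eq_bigr => i _; rewrite fconsS permM; case: eqP => [->|ne].
    by rewrite tpermR lift_perm_id fcons0.
  rewrite tpermD ?neq_lift ?lift_perm_lift ?fconsS // (inj_eq lift_inj) eq_sym.
  exact/eqP.
rewrite IHs => [|x|x|i]; try exact: generic_exp_homog.
congr (_ * _); apply: eq_bigr => i _; rewrite /merge_exp; case: eqP => // ->.
by rewrite exprD -mulmxE mxE.
Qed.

Lemma perm_trace0 (h : 'I_0 -> nat) s : perm_trace h s = 1.
Proof.
rewrite /perm_trace (bigD1 [ffun i : 'I_0 => False_rect 'I_d (notF (ltn_ord i))]) //=.
rewrite big_ord0 big1 ?addr0 // => a /eqP []; apply/ffunP; by case.
Qed.

(** [B] groups the exponents by the cycles of [t], whence the parity clause. The parity and the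
    control of the sign [s] serve the proof of [trace_gt]. *)
Lemma perm_trace_cycles N (h : 'I_N -> nat) (t : 'S_N) :
  exists B : seq (seq nat), exists s : bool,
  [/\ perm_eq (flatten B) [seq h i | i <- enum 'I_N], [::] \notin B,
      (t : bool) = odd N (+) odd (size B),
      (\sum_i odd (h i) <= 1)%N -> s = false
    & perm_trace h t = (-1) ^+ s * \prod_(b <- B) T (sumn b)].
Proof.
elim: N h t => [|N IH] h t.
  exists [::], false; split => //.
  - by rewrite enum_ord0.
  - by rewrite (_ : t = 1%g) ?odd_perm1 //; apply/permP; case.
  - by rewrite perm_trace0 big_nil mulr1.
have [t' [->|[j ->]]] := perm_recl t.
  have [B [s [pB B0 ot s0 E]]] := IH (fun j => h (lift ord0 j)) t'.
  exists ([:: h ord0] :: B), s; split.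
  - by rewrite enum_ordSl /= perm_cons -map_comp.
  - by rewrite inE negb_or B0.
  - by rewrite odd_lift_perm /= ot addNb addbN negbK.
  - rewrite big_ord_recl => le; apply: s0; apply: leq_trans le; exact: leq_addl.
  - by rewrite perm_trace_fix E big_cons /= addn0 signr_mulCA.
have [B [s [pB B0 ot s0 E]]] := IH (merge_exp h j) t'.
have [s1 s10 E1] := perm_trace_merge h j.
set v := (h (lift ord0 j) + h ord0)%N.
have pv : perm_eq (flatten B) (v :: [seq h (lift ord0 i) | i <- rem j (enum 'I_N)]).
  have -> : [seq h (lift ord0 i) | i <- rem j (enum 'I_N)] =
      [seq merge_exp h j i | i <- rem j (enum 'I_N)]; last first.
    have -> : v = merge_exp h j j by rewrite /merge_exp eqxx.
    by rewrite (perm_trans pB) // (perm_trans (perm_map _ (perm_to_rem (mem_enum 'I_N j)))).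
  apply/eq_in_map => i; rewrite mem_rem_uniq ?enum_uniq // !inE => /andP [ne _].
  by rewrite /merge_exp (negbTE ne).
(* Undoing the merge: one occurrence of [v] is replaced by the two exponents it is the sum of. Only
   multisets are tracked, so any bin containing the value [v] will do. *)
have /flattenP [b bB vb] : v \in flatten B by rewrite (perm_mem pv) mem_head.
have pb := perm_to_rem vb.
have sum_b : sumn b = sumn [:: h ord0, h (lift ord0 j) & rem v b].
  by rewrite (perm_sumn pb) /= -addnA addnCA.
case/splitPr: B / bB pB B0 ot E pv => B1 B2 pB B0 ot E pv.
exists (B1 ++ [:: h ord0, h (lift ord0 j) & rem v b] :: B2), (s1 (+) s); split.
- rewrite enum_ordSl /= -map_comp.
  rewrite (perm_trans (_ : perm_eq _ (h ord0 :: h (lift ord0 j) :: rem v b ++ flatten B2 ++ flatten B1))) //.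
    by rewrite flatten_cat /= perm_catC /= !perm_cons -catA.
  rewrite perm_cons perm_sym (perm_trans (perm_map _ (perm_to_rem (mem_enum 'I_N j)))) //=.
  rewrite perm_cons -(perm_cons v) perm_sym -(permPr pv) flatten_cat /=.
  rewrite perm_sym perm_catC /= -catA -cat_cons.
  by rewrite perm_cat2r.
- by move: B0; rewrite !mem_cat !inE /= !negb_or => /andP [-> /andP []].
- by rewrite odd_mul_tperm neq_lift odd_lift_perm /= ot !size_cat /= addNb.
- move=> le; rewrite s10 // s0 //; apply: leq_trans le.
  exact: merge_exp_odd.
- rewrite E1 E signr_addb -mulrA; congr (_ * (_ * _)).
  by rewrite !big_cat !big_cons /= sum_b.
Qed.

(** With more than [d] slots every index function [a] takes some value twice; composing [t] with
    that transposition changes the sign of the term and nothing else. *)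
Lemma perm_trace_alt N (h : 'I_N -> nat) : (d < N)%N ->
  \sum_(t : 'S_N) (-1) ^+ t * perm_trace h t = 0.
Proof.
move=> lt_dN; under eq_bigr do rewrite big_distrr.
rewrite exchange_big big1 //= => a _.
have /injectivePn [i [j ne eq_a]] : ~~ injectiveb a.
  by apply: contraL lt_dN => /injectiveP/leq_card; rewrite !card_ord -leqNgt.
apply: gr_eqN; rewrite {1}(reindex_inj (mulIg (tperm i j))) /= -sumrN.
apply: eq_bigr => t _; rewrite odd_permM odd_tperm ne addbT signrN mulNr.
congr (- (_ * _)); apply: eq_bigr => k _; rewrite permM.
by case: tpermP => [->|->|] //; rewrite eq_a.
Qed.

Lemma merge_exp_sum N (h : 'I_N.+1 -> nat) j :
  (\sum_i merge_exp h j i = \sum_i h i)%N.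
Proof.
rewrite big_ord_recl (bigD1 j) //= [X in (_ = _ + X)%N](bigD1 j) //= addnA.
rewrite {1}/merge_exp eqxx [(h ord0 + _)%N]addnC; congr (_ + _)%N.
by apply: eq_bigr => i ne; rewrite /merge_exp (negbTE ne).
Qed.

Lemma perm_trace_long N (h : 'I_N.+1 -> nat) : (\sum_i odd (h i) <= 1)%N ->
  exists t, perm_trace h t = T (\sum_i h i)%N.
Proof.
elim: N h => [|N IH] h le1.
  exists (lift_perm ord0 ord0 1%g).
  by rewrite perm_trace_fix perm_trace0 mulr1 big_ord_recl big_ord0 addn0.
have [t Et] := IH _ (leq_trans (merge_exp_odd h ord0) le1).
have [s s0 E] := perm_trace_merge h ord0.
exists (tperm ord0 (lift ord0 ord0) * lift_perm ord0 ord0 t)%g.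
by rewrite E s0 // mul1r Et merge_exp_sum.
Qed.

Lemma odd_sumn_le (b : seq nat) : (odd (sumn b) <= \sum_(x <- b) odd x)%N.
Proof.
elim: b => [|x b IH]; first by rewrite big_nil.
by rewrite big_cons /= oddD; apply: leq_trans (leq_add (leqnn _) IH); do 2 case: (odd _).
Qed.

Lemma prod_trace_odd (B : seq (seq nat)) :
  all (all (fun x => 0 < x)%N) B -> [::] \notin B -> \prod_(b <- B) T (sumn b) != 0 ->
  all odd (map sumn B).
Proof.
move=> pos ne nz; rewrite all_map; apply/allP=> b bB /=; apply: contraNT nz => ob.
case/splitPr: B / bB pos ne => B1 B2; rewrite all_cat mem_cat inE /= !negb_or.
case/and3P=> _ pos _ /and3P [_ ne _]; rewrite big_cat big_cons /= trace_even ?mul0r ?mulr0 //.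
by case: b pos ne {ob} => //= x b /andP [x0 _] _; rewrite addn_gt0 x0.
Qed.

Lemma sum_flatten (f : nat -> nat) (B : seq (seq nat)) :
  (\sum_(x <- flatten B) f x = \sum_(b <- B) \sum_(x <- b) f x)%N.
Proof. by elim: B => [|b B IH] /=; rewrite ?big_nil // big_cat big_cons IH. Qed.

(* Amitsur-Levitzki, from the vanishing of the antisymmetrizer on d + 1 slots
   carrying [X ^+ 2], ..., [X ^+ 2], [X ^+ (c - 2 * d)]: even traces vanish, so
   only the full cycles contribute, all with the same sign. *)
Lemma trace_gt c : odd c -> (2 * d < c)%N -> T c = 0.
Proof.
move=> oc lt_dc.
pose h (i : 'I_d.+1) := if i == ord0 then (c - 2 * d)%N else 2%N.
have hS i : h (lift ord0 i) = 2%N by [].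
have h0 : h ord0 = (c - 2 * d)%N by [].
have sum_h : (\sum_i h i = c)%N.
  rewrite big_ord_recl h0; under eq_bigr do rewrite hS.
  by rewrite sum_nat_const card_ord [(d * 2)%N]mulnC subnK // ltnW.
have odd_h : (\sum_i odd (h i) = 1)%N.
  rewrite big_ord_recl h0 big1 // oddB ?(ltnW lt_dc) // oc mul2n odd_double //.
have [t Et] := perm_trace_long (eq_leq odd_h); rewrite sum_h in Et.
have posh i : (0 < h i)%N by rewrite /h; case: eqP => _ //; rewrite subn_gt0.
have dich u : perm_trace h u = 0 \/ perm_trace h u = T c /\ (u : bool) = odd d.
  have [B [s [pB B0 ou s0 E]]] := perm_trace_cycles h u.
  rewrite s0 ?odd_h // mul1r in E.
  have [z|nz] := eqVneq (perm_trace h u) 0; [by left | right].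
  have posB : all (all (fun x => 0 < x)%N) B.
    apply/allP=> b bB; apply/allP=> x xb; have : x \in flatten B by apply/flattenP; exists b.
    by rewrite (perm_mem pB) => /mapP [i _ ->].
  have oB : all odd (map sumn B) by apply: prod_trace_odd => //; rewrite -E.
  (* Every bin has an odd sum, hence contains an odd exponent, and [h] has only one. *)
  have sB : (size B <= 1)%N.
    rewrite -odd_h -(big_enum _ _ predT) /= -(big_map h predT (fun x => nat_of_bool (odd x))) /=.
    rewrite -(perm_big _ pB) /= sum_flatten -sum1_size; elim: B oB {pB B0 ou E posB} => [|b B IH] /=.
      by rewrite big_nil.
    case/andP=> ob /IH le; rewrite !big_cons; apply: leq_add le.
    by have := odd_sumn_le b; rewrite ob.
  have sumB : sumn (flatten B) = c.
    rewrite (perm_sumn pB) sumnE big_map big_enum /= sum_h //.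
  case: B sB sumB E ou {pB B0 posB oB} => [|b [|//]] _ /= sumB E ou.
    by move: oc; rewrite -sumB.
  rewrite cats0 in sumB; rewrite E big_seq1 sumB; split=> //.
  by rewrite ou addbT negbK.
have S0 : \sum_u perm_trace h u = 0.
  rewrite -[LHS](signrMK (odd d)) big_distrr /= -[RHS](mulr0 ((-1) ^+ odd d)).
  rewrite -[X in _ = _ * X](perm_trace_alt h (ltnSn d)); congr (_ * _).
  by apply: eq_bigr => u _; case: (dich u) => [->|[_ ->]]; rewrite ?mulr0.
have [//|nz] := eqVneq (T c) 0.
move: S0; rewrite (bigID (fun u => perm_trace h u == T c)) /= addrC big1 ?add0r; last first.
  by move=> u; case: (dich u) => [->|[-> _]] //; rewrite eqxx.
rewrite (eq_bigr (fun=> T c)) => [|u /eqP //]; rewrite sumr_const.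
have tin : t \in [pred u | perm_trace h u == T c] by rewrite inE Et.
by rewrite (cardD1 t) [t \in _]tin add1n => /gr_torsion.
Qed.

Lemma sum_odds n : (\sum_(i <- iota 0 n) i.*2.+1 = n * n)%N.
Proof.
elim: n => [|n IH]; first by rewrite big_nil.
by rewrite -addn1 iotaD big_cat /= IH big_seq1 add0n; lia.
Qed.

(** Distinct odd numbers below [2 * d] form a subset of 1, 3, ..., 2d-1, whose total is already d^2;
    so none is missing. *)
Lemma odds_perm (cs : seq nat) :
  uniq cs -> all odd cs -> all (fun c => c < 2 * d)%N cs -> sumn cs = (d * d)%N ->
  perm_eq cs [seq i.*2.+1 | i <- iota 0 d].
Proof.
move=> ucs ocs lcs scs; set os := map _ _.
have uos : uniq os by rewrite map_inj_uniq ?iota_uniq // => i j [] /double_inj.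
have sub : {subset cs <= os}.
  move=> c cin; apply/mapP; exists c./2.
    by rewrite mem_iota add0n /=; have := allP lcs _ cin; lia.
  by have := odd_double_half c; rewrite (allP ocs _ cin).
apply: uniq_perm => // c; apply/idP/idP => [/sub //|cin].
have so : sumn os = (d * d)%N by rewrite sumnE big_map sum_odds.
have E : (\sum_(x <- os) x = \sum_(x <- os | x \in cs) x + \sum_(x <- os | x \notin cs) x)%N.
  exact: bigID.
have pf : perm_eq [seq x <- os | x \in cs] cs.
  apply: uniq_perm; rewrite ?filter_uniq // => x; rewrite mem_filter.
  by case: (boolP (x \in cs)) => // /sub ->.
rewrite -sumnE so -big_filter (perm_big _ pf) /= -sumnE scs in E.
apply: contraT => nc; have : (c <= \sum_(x <- os | x \notin cs) x)%N.
  by rewrite (big_rem c) //= nc leq_addr.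
have -> : (\sum_(x <- os | x \notin cs) x = 0)%N.
  by apply/eqP; rewrite -(eqn_add2l (d * d)) -E addn0.
by rewrite leqn0 => /eqP c0; move: cin; rewrite c0 => /mapP [].
Qed.

Lemma perm_trace_bins N (h : 'I_N -> nat) (t : 'S_N) :
  (forall i, 0 < h i)%N -> (\sum_i h i = d * d)%N -> perm_trace h t != 0 ->
  exists B : seq (seq nat), exists s : bool,
  [/\ perm_eq (flatten B) [seq h i | i <- enum 'I_N],
      perm_eq (map sumn B) [seq i.*2.+1 | i <- iota 0 d]
    & perm_trace h t = (-1) ^+ s * \prod_(c <- map sumn B) T c].
Proof.
move=> posh sumh nz; have [B [s [pB B0 _ _ E]]] := perm_trace_cycles h t.
exists B, s; split=> //; last by rewrite E big_map.
have posB : all (all (fun x => 0 < x)%N) B.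
  apply/allP=> b bB; apply/allP=> x xb; have : x \in flatten B by apply/flattenP; exists b.
  by rewrite (perm_mem pB) => /mapP [i _ ->].
have nzB : \prod_(b <- B) T (sumn b) != 0.
  by apply: contraNneq nz => z; rewrite E z mulr0.
have oB := prod_trace_odd posB B0 nzB.
apply: odds_perm => //.
- by apply: trace_prod_uniq => //; rewrite big_map.
- rewrite all_map; apply/allP=> b bB /=; rewrite ltnNge leq_eqVlt negb_or.
  have ob : odd (sumn b) by apply: (allP oB); apply: map_f.
  apply/andP; split; first by apply: contraTneq ob => <-; rewrite mul2n odd_double.
  apply: contraNN nzB => lt; apply/eqP.
  case/splitPr: B / bB {pB B0 E posB oB} => B1 B2.
  by rewrite big_cat big_cons /= trace_gt // mul0r mulr0.
- rewrite -sumh sumnE big_map.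
  have -> : (\sum_(b <- B) sumn b = \sum_(x <- flatten B) x)%N.
    by rewrite sum_flatten; apply: eq_bigr => b _; rewrite sumnE.
  by rewrite (perm_big _ pB) /= big_map big_enum.
Qed.

End Traces.

(** * Invariant tensors *)

Section Positivity.
Variables (T : finType) (N : nat).
Implicit Types (a b c x y z : {ffun 'I_N -> T}) (s t : 'S_N).

Definition reidx s b : {ffun 'I_N -> T} := [ffun i => b (s i)].

Lemma reidxM s t b : reidx s (reidx t b) = reidx (s * t)%g b.
Proof. by apply/ffunP=> i; rewrite !ffunE permM. Qed.

Lemma reidx1 b : reidx 1%g b = b.
Proof. by apply/ffunP=> i; rewrite !ffunE perm1. Qed.

Lemma reidxK s : cancel (reidx s) (reidx s^-1%g).
Proof. by move=> b; rewrite reidxM mulVg reidx1. Qed.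

Lemma reidxKV s : cancel (reidx s^-1%g) (reidx s).
Proof. by move=> b; rewrite reidxM mulgV reidx1. Qed.

(* [sum_(s in Stab c) v (s.b)] is up to a positive factor the orthogonal projection
   of [v] on the Stab(c)-invariants, whence a sum of squares. *)
Lemma stab_form_sqr (v : {ffun 'I_N -> T} -> rat) c :
  (\sum_b \sum_(s | reidx s c == c) v b * v (reidx s b)) *+ #|[pred s | reidx s c == c]| =
  \sum_b (\sum_(s | reidx s c == c) v (reidx s b)) ^+ 2.
Proof.
under [RHS]eq_bigr do rewrite expr2 big_distrl.
rewrite [RHS]exchange_big -sumr_const /=; apply: eq_bigr => s; rewrite ?inE => /eqP sc.
rewrite [RHS](reindex_inj (can_inj (reidxKV s))) /=; apply: eq_bigr => b _.
rewrite reidxKV big_distrr [RHS](reindex_inj (mulIg s)) /=; apply: eq_big => t.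
  by rewrite -reidxM sc.
by rewrite !reidxM -mulgA mulgV mulg1.
Qed.

(** The first hypothesis is commutation with symmetrized elementary tensors, the second
    orthogonality to permutations. Taking [z := c] and summing over [c] turns the second into [R0],
    so the nonnegative forms [Q c] add up to 0 and each vanishes. In [Q y], the square indexed by
    [y] is that of a positive multiple of [C x y]. *)
Lemma commutant_eq0 (C : {ffun 'I_N -> T} -> {ffun 'I_N -> T} -> rat) :
  (forall b c x z, \sum_(s | reidx s b == x) C (reidx s c) z =
                   \sum_(s | reidx s c == z) C x (reidx s b)) ->
  (forall s, \sum_a C a (reidx s a) = 0) ->
  forall x y, C x y = 0.
Proof.
move=> Ccomm Ctr x y.
have R0 b : \sum_c \sum_(s | reidx s c == c) C x (reidx s b) = 0.
  under eq_bigr do rewrite -Ccomm.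
  rewrite exchange_big big1 // => s _.
  rewrite (reindex_inj (can_inj (reidxKV s))) /= -[RHS](Ctr s^-1%g).
  by apply: eq_bigr => a _; rewrite reidxKV.
pose Q c := \sum_b \sum_(s | reidx s c == c) C x b * C x (reidx s b).
have cardS c : (0 < #|[pred s | reidx s c == c]|)%N.
  by apply/card_gt0P; exists 1%g; rewrite inE reidx1.
have Q_ge0 c : 0 <= Q c.
  rewrite -(pmulrn_lge0 _ (cardS c)) stab_form_sqr; apply: sumr_ge0 => b _.
  exact: sqr_ge0.
have sumQ : \sum_c Q c = 0.
  rewrite exchange_big big1 // => b _.
  under eq_bigr do rewrite -big_distrr.
  by rewrite -big_distrr /= R0 mulr0.
have Qy : Q y = 0 by apply: (psumr_eq0P _ sumQ).
have := stab_form_sqr (C x) y; rewrite -/(Q y) Qy mul0rn => /esym E.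
have {E} := psumr_eq0P (fun b _ => sqr_ge0 _) E (i := y) isT.
move/eqP; rewrite sqrf_eq0 (eq_bigr (fun=> C x y)) => [|s /eqP -> //].
rewrite sumr_const mulrn_eq0 => /orP [|/eqP //]; by rewrite eqn0Ngt cardS.
Qed.

End Positivity.

(** * Polarization of products of linear forms, and an invertible shift *)

Section Polarization.
Variables (N : nat) (u : 'I_N -> rat) (v : 'I_N -> 'I_N -> rat).

Let allowed (S : {set 'I_N}) (o : option 'I_N) := if o is Some j then j \in S else true.
Let V (o : option 'I_N) i := if o is Some j then v j i else u i.

(** Inclusion-exclusion over [S]: expanding each factor chooses [None] for [u] or [Some j] for
    [v j], and only the choices using every [j] survive. *)
Lemma polarization :
  \sum_(S : {set 'I_N}) (-1) ^+ #|~: S| * \prod_i (u i + \sum_(j in S) v j i) =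
  \sum_(s : 'S_N) \prod_i v (s i) i.
Proof.
pose F (S : {set 'I_N}) (f : {ffun 'I_N -> option 'I_N}) : rat :=
  (-1) ^+ #|~: S| * \prod_i ((allowed S (f i))%:R * V (f i) i).
have E1 : \sum_(S : {set 'I_N}) (-1) ^+ #|~: S| * \prod_i (u i + \sum_(j in S) v j i) =
   \sum_(f : {ffun 'I_N -> option 'I_N}) \sum_S F S f.
  rewrite exchange_big; apply: eq_bigr => S _; rewrite -big_distrr /=; congr (_ * _).
  rewrite -(bigA_distr_bigA (fun i o => (allowed S o)%:R * V o i)) /=.
  apply: eq_bigr => i _; rewrite (bigD1 None) //= mul1r; congr (_ + _).
  rewrite (reindex_omap Some id) /=; last by case.
  rewrite [RHS](bigID (mem S)) /= [X in _ = _ + X]big1 ?addr0; last first.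
    by move=> j /andP [_ /negbTE ->]; rewrite mul0r.
  by apply: eq_big => [j|j ->]; rewrite ?eqxx ?mul1r ?andbT.
pose im (f : {ffun 'I_N -> option 'I_N}) j := [exists i, f i == Some j].
rewrite E1 (bigID (fun f => [forall j, im f j])) /= [X in _ + X]big1 ?addr0; last first.
  move=> f /forallPn [j nj].
  (* If [f] misses [j], adding [j] to [S] or removing it leaves the product unchanged and flips the
     sign, so the sum over [S] cancels in pairs. *)
  pose tog (S : {set 'I_N}) := if j \in S then S :\ j else j |: S.
  have togK : involutive tog.
    move=> S; rewrite /tog; case jS: (j \in S); first by rewrite !inE eqxx setD1K.
    by rewrite !inE eqxx setU1K ?jS.
  have togF S : F (tog S) f = - F S f.
    rewrite /F -mulNr; congr (_ * _); last first.
      apply: eq_bigr => i _; congr (_%:R * _); case fi: (f i) => [k|] //=.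
      have kj : k != j by apply: contraNneq nj => <-; apply/existsP; exists i; rewrite fi.
      by rewrite /tog; case: ifP => _; rewrite !inE (negbTE kj).
    rewrite -[RHS]mulN1r -exprS; apply/eqP.
    rewrite -[_ ^+ #|~: tog S|]signr_odd -[_ ^+ _.+1]signr_odd; apply/eqP; congr (_ ^+ _).
    have odd1 (A : {set 'I_N}) : j \in A -> odd #|~: (A :\ j)| = ~~ odd #|~: A|.
      move=> jA; rewrite setCD setUC cardsU1 inE jA oddD /=; by case: odd.
    rewrite /tog; case jS: (j \in S); first by rewrite odd1.
    have := @odd1 (j |: S) (setU11 _ _); rewrite setU1K ?jS // oddS => ->.
    by rewrite negbK.
  suff : (\sum_S F S f) *+ 2 = 0 by move/eqP; rewrite mulrn_eq0 => /eqP.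
  rewrite mulr2n {1}(reindex_inj (inv_inj togK)) /=.
  by rewrite -big_split big1 //= => S _; rewrite togF addNr.
(* If [f] hits every [j], a set [S] omitting some [j] gives a zero factor, so only [setT]
   remains. *)
rewrite (eq_bigr (fun f : {ffun 'I_N -> option 'I_N} => \prod_i V (f i) i)) => [|f /forallP imf]; last first.
  rewrite (bigD1 setT) //= [X in _ + X]big1 ?addr0.
    rewrite /F setCT cards0 mul1r; apply: eq_bigr => i _.
    by case: (f i) => [j|] /=; rewrite ?inE mul1r.
  move=> S neT; have [j jS] : exists j, j \notin S.
    by apply/existsP; apply: contraR neT => /existsPn H; apply/eqP/setP=> j; rewrite inE; apply/negPn.
  have /existsP [i /eqP fi] := imf j.
  by rewrite /F (bigD1 i) //= fi /= (negbTE jS) !mul0r mulr0.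
(* With [N] slots and [N] values to hit, such an [f] takes no value twice and avoids [None]: it is a
   permutation. *)
have some_inj : injective (fun s : 'S_N => [ffun i => Some (s i)]).
  by move=> s t /ffunP E; apply/permP=> i; have := E i; rewrite !ffunE => - [].
rewrite (reindex (fun s : 'S_N => [ffun i => Some (s i)])) /=.
  apply: eq_big => [s|s _]; last by apply: eq_bigr => i _; rewrite ffunE.
  by apply/forallP=> j; apply/existsP; exists ((s^-1)%g j); rewrite ffunE permKV.
have ex f : [forall j, im f j] -> exists s : 'S_N, [ffun i => Some (s i)] == f.
  move/forallP=> H; have pre j : exists i, f i == Some j by apply/existsP/H.
  pose g j := xchoose (pre j); have gE j : f (g j) = Some j by apply/eqP/(xchooseP (pre j)).
  have g_inj : injective g by move=> i j E; apply: Some_inj; rewrite -!gE E.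
  exists (perm g_inj)^-1%g; apply/eqP/ffunP=> i; rewrite ffunE -gE; congr (f _).
  by rewrite -(permE g_inj) permKV.
exists (fun f : {ffun 'I_N -> option 'I_N} => odflt 1%g [pick s : 'S_N | [ffun i => Some (s i)] == f]) => [s _|f /ex [s0 s0E]].
  by case: pickP => [t /eqP /some_inj //|/(_ s)]; rewrite eqxx.
by case: pickP => [t /eqP //|/(_ s0)]; rewrite s0E.
Qed.

End Polarization.

(** The product of the characteristic polynomials of the [- A i] has finitely many roots, so some
    natural number is an eigenvalue of none of them. *)
Lemma shift_unit d (I : finType) (A : I -> 'M[rat]_d) :
  exists t : rat, forall i, t%:M + A i \in unitmx.
Proof.
pose p := \prod_i char_poly (- A i).
have p0 : p != 0 by rewrite prodf_seq_neq0; apply/allP=> i _; rewrite monic_neq0 ?char_poly_monic.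
have [n nr] : exists n : nat, ~~ root p n%:R.
  case: (boolP (all (root p) [seq n%:R | n <- iota 0 (size p)])) => [all_r|/allPn [x /mapP [n _ ->]]]; last by exists n.
  have us : uniq [seq n%:R : rat | n <- iota 0 (size p)].
    by rewrite map_inj_uniq ?iota_uniq // => a b /eqP; rewrite eqr_nat => /eqP.
  by have := max_poly_roots p0 all_r us; rewrite size_map size_iota ltnn.
exists n%:R => i; move: nr; rewrite /root horner_prod prodf_seq_neq0.
move/allP/(_ i (mem_index_enum _)) => /=.
rewrite -/(root _ _) -eigenvalue_root_char /eigenvalue negbK /eigenspace kermx_eq0.
by rewrite row_free_unit -opprD addrC -scaleN1r unitmxZ // unitrN1.
Qed.

(** * Expansion of matrix products into words of entries *)

Section Words.
Variable d : nat.
Local Notation I := ('I_d * 'I_d)%type.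

Fixpoint walks h (a b : 'I_d) : seq (seq I) :=
  if h is h'.+1 then [seq (a, c) :: w | c <- enum 'I_d, w <- walks h' c b]
  else if a == b then [:: [::]] else [::].

Fixpoint words (hs : seq nat) (es : seq I) : seq (seq I) :=
  match hs, es with
  | h :: hs', e :: es' => [seq u ++ v | u <- walks h e.1 e.2, v <- words hs' es']
  | _, _ => [:: [::]]
  end.

(** Coordinate [es] of the tensor product of consecutive blocks, of lengths [hs], cut from the one
    sequence [Z]. *)
Fixpoint blocks (R : pzRingType) (hs : seq nat) (es : seq I) (Z : nat -> 'M[R]_d) : R :=
  match hs, es with
  | h :: hs', e :: es' => (\big[mulmx/1%:M]_(0 <= i < h) Z i) e.1 e.2 *
                          blocks hs' es' (fun i => Z (h + i)%N)
  | _, _ => 1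
  end.

Lemma size_walks h a b w : w \in walks h a b -> size w = h.
Proof.
elim: h a w => [|h IH] a w /=; first by case: (a == b); rewrite ?inE // => /eqP ->.
by case/allpairsPdep=> c [u [_ /IH su ->]] /=; rewrite su.
Qed.

Lemma walksE (R : pzRingType) (Z : nat -> 'M[R]_d) e0 h a b :
  (\big[mulmx/1%:M]_(0 <= i < h) Z i) a b =
  \sum_(w <- walks h a b) \prod_(i < h) Z i (nth e0 w i).1 (nth e0 w i).2.
Proof.
elim: h Z a => [|h IH] Z a /=.
  rewrite big_geq // mxE; case: (a == b); last by rewrite big_nil.
  by rewrite big_seq1 big_ord0.
rewrite big_nat_recl // mxE big_allpairs_dep big_enum /=.
apply: eq_bigr => c _; rewrite IH big_distrr; apply: eq_bigr => w _ /=.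
by rewrite big_ord_recl.
Qed.

Lemma blocksE (R : pzRingType) (Z : nat -> 'M[R]_d) e0 hs es : size hs = size es ->
  blocks hs es Z =
  \sum_(w <- words hs es) \prod_(i < sumn hs) Z i (nth e0 w i).1 (nth e0 w i).2.
Proof.
elim: hs es Z => [|h hs IH] [|e es] Z //=; first by rewrite big_seq1 big_ord0.
case=> ss; rewrite (walksE _ e0) (IH _ _ ss) big_allpairs_dep big_distrl /=.
apply: eq_big_seq => u /size_walks su; rewrite big_distrr; apply: eq_bigr => v _ /=.
rewrite big_split_ord /=; congr (_ * _); apply: eq_bigr => i _ /=.
  by rewrite nth_cat su ltn_ord.
by rewrite nth_cat su ltnNge leq_addr /= addKn.
Qed.

Definition entry_prod (R : pzRingType) (Y : 'M[R]_d) (hs : seq nat) (es : seq I) : R :=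
  \prod_(x <- zip hs es) (Y ^+ x.1) x.2.1 x.2.2.

Lemma entry_prod_blocks (R : pzRingType) (Y : 'M[R]_d) hs es :
  entry_prod Y hs es = blocks hs es (fun=> Y).
Proof.
rewrite /entry_prod; elim: hs es => [|h hs IH] [|e es] //=; rewrite ?big_nil //.
rewrite big_cons IH /=; congr (_ e.1 e.2 * _).
by rewrite mulmxE -[1%:M]/(1 : 'M_d) prodr_const_nat subn0.
Qed.

Lemma entry_prodE (R : pzRingType) (Y : 'M[R]_d) e0 hs es : size hs = size es ->
  entry_prod Y hs es =
  \sum_(w <- words hs es) \prod_(i < sumn hs) Y (nth e0 w i).1 (nth e0 w i).2.
Proof. by move=> ss; rewrite entry_prod_blocks (blocksE _ e0). Qed.

Lemma entry_prod_cat (R : pzRingType) (Y : 'M[R]_d) hs es hs' es' : size hs = size es ->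
  entry_prod Y (hs ++ hs') (es ++ es') = entry_prod Y hs es * entry_prod Y hs' es'.
Proof. by move=> ss; rewrite /entry_prod zip_cat // big_cat. Qed.

Lemma entry_prod_ord (R : pzRingType) (Y : 'M[R]_d) N (h : 'I_N -> nat) (e : 'I_N -> I) :
  \prod_(j < N) (Y ^+ h j) (e j).1 (e j).2 =
  entry_prod Y [seq h j | j <- enum 'I_N] [seq e j | j <- enum 'I_N].
Proof. by rewrite /entry_prod zip_map big_map enumT /index_enum unlock. Qed.

End Words.

(** * Invariance of the tensor of top coefficients under linear substitutions *)

Section Invariance.
Variables (d : nat) (G : grassmann (d * d)).
Hypothesis d_gt0 : (0 < d)%N.
Local Notation xi := (gr_gen G).
Local Notation iota := (gr_scal G).
Local Notation phi := (@berezin _ G).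
Local Notation X := (generic_mx G).
Local Notation M := (d * d)%N.

Lemma scal_prod (J : Type) (r : seq J) (c : J -> rat) (x : J -> G) :
  \prod_(i <- r) (iota (c i) * x i) = iota (\prod_(i <- r) c i) * \prod_(i <- r) x i.
Proof.
elim: r => [|i r IH]; first by rewrite !big_nil rmorph1 mulr1.
rewrite !big_cons IH rmorphM -!mulrA; congr (_ * _).
by rewrite !mulrA (gr_scalC (\prod_(j <- r) c j) (x i)).
Qed.

Lemma berezin_perm (s : 'S_M) : phi (\prod_i xi (s i)) = (-1) ^+ s.
Proof.
have -> := gen_word_perm G (fun i => i) s.
by rewrite berezin_sign berezin_top mulr1.
Qed.

(** After expansion, words with a repeated generator vanish and the others are permutations weighted
    by their sign: the Leibniz formula. *)
Lemma berezin_det (B : 'M[rat]_M) :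
  phi (\prod_p \sum_q iota (B p q) * xi q) = \det B.
Proof.
rewrite bigA_distr_bigA raddf_sum /=.
under eq_bigr do rewrite scal_prod berezinZ.
rewrite (bigID (fun f : {ffun 'I_M -> 'I_M} => injectiveb f)) /= addrC big1 ?add0r; last first.
  move=> f /injectivePn [i [j ne eq_f]].
  by rewrite (gen_word_eq0 G ne eq_f) raddf0 mulr0.
rewrite (reindex (@pval _)) /=; last first.
  pose in_Sn := insubd (1%g : 'S_M).
  by exists in_Sn => f Uf; first apply: val_inj; apply: insubdK.
apply: eq_big => /= [s | s _]; first by rewrite (valP s).
rewrite mulrC -berezin_perm; congr (phi _ * _); first by apply: eq_bigr => i _; rewrite pvalE.
by apply: eq_bigr => i _; rewrite pvalE.
Qed.

Lemma berezin_linear_change (L : 'M[rat]_M) (Y : 'M[G]_d) (w : nat -> 'I_d * 'I_d) :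
  (forall a b, Y a b = \sum_q iota (L (mxvec_index a b) q) * xi q) ->
  phi (\prod_(p < M) Y (w p).1 (w p).2) =
  \det L * phi (\prod_(p < M) X (w p).1 (w p).2).
Proof.
(* Row [p] of [D] selects the letter at position [p], so the two sides are the determinant of
   [D *m L] and the product of determinants. *)
move=> YE; pose D := \matrix_(p < M, r < M) (r == mxvec_index (w p).1 (w p).2)%:R : 'M[rat]_M.
have DE (A : 'M[rat]_M) p q : (D *m A) p q = A (mxvec_index (w p).1 (w p).2) q.
  rewrite mxE (bigD1 (mxvec_index (w p).1 (w p).2)) //= big1 ?addr0 ?mxE ?eqxx ?mul1r //.
  by move=> r /negbTE ne; rewrite mxE ne mul0r.
have -> : \prod_(p < M) X (w p).1 (w p).2 = \prod_p \sum_q iota (D p q) * xi q.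
  apply: eq_bigr => p _; rewrite (bigD1 (mxvec_index (w p).1 (w p).2)) //= big1 ?addr0.
    by rewrite !mxE eqxx rmorph1 mul1r.
  by move=> r /negbTE ne; rewrite mxE ne rmorph0 mul0r.
have -> : \prod_(p < M) Y (w p).1 (w p).2 = \prod_p \sum_q iota ((D *m L) p q) * xi q.
  by apply: eq_bigr => p _; rewrite YE; apply: eq_bigr => q _; rewrite DE.
by rewrite !berezin_det det_mulmx mulrC.
Qed.

Lemma berezin_entry_change (L : 'M[rat]_M) (Y : 'M[G]_d) hs es :
  (forall a b, Y a b = \sum_q iota (L (mxvec_index a b) q) * xi q) ->
  size hs = size es -> sumn hs = M ->
  phi (entry_prod Y hs es) = \det L * phi (entry_prod X hs es).
Proof.
move=> YE ss sM; pose o := Ordinal d_gt0; pose e0 := (o, o).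
rewrite !(entry_prodE _ e0 ss) sM !raddf_sum big_distrr; apply: eq_bigr => w _ /=.
exact: berezin_linear_change.
Qed.

Lemma lin_mx_mul (R : comNzRingType) m1 n1 m2 n2 m3 n3
  (f : {linear 'M[R]_(m1, n1) -> 'M[R]_(m2, n2)})
  (g : {linear 'M[R]_(m2, n2) -> 'M[R]_(m3, n3)})
  (k : {linear 'M[R]_(m1, n1) -> 'M[R]_(m3, n3)}) :
  (forall A, g (f A) = k A) -> lin_mx f *m lin_mx g = lin_mx k.
Proof.
move=> E; apply/row_matrixP=> i; rewrite !rowE mulmxA.
by rewrite -[delta_mx 0 i]vec_mxK !mul_vec_lin E.
Qed.

Lemma lin_mx_id (R : comNzRingType) m n (f : {linear 'M[R]_(m, n) -> 'M[R]_(m, n)}) :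
  (forall A, f A = A) -> lin_mx f = 1%:M.
Proof.
move=> E; apply/row_matrixP=> i; rewrite !rowE mulmx1.
by rewrite -[delta_mx 0 i]vec_mxK mul_vec_lin E.
Qed.

Local Notation lmul := (@lin_mulmx rat d d d).
Local Notation rmul := (@lin_mulmxr rat d d d).

Lemma lin_mulmxE (g : 'M[rat]_d) a b c e :
  lmul g (mxvec_index c e) (mxvec_index a b) = g a c * (b == e)%:R.
Proof.
have -> : lmul g (mxvec_index c e) (mxvec_index a b) =
   ((delta_mx 0 (mxvec_index c e) : 'rV_(d * d)) *m lmul g) 0 (mxvec_index a b) by rewrite -rowE [RHS]mxE.
rewrite -mxvec_delta mul_vec_lin mxvecE mxE (bigD1 c) //= big1 ?addr0.
  by rewrite mxE eqxx eq_sym.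
by move=> i /negbTE ne; rewrite mxE ne mulr0.
Qed.

Lemma lin_mulmxrE (g : 'M[rat]_d) a b c e :
  rmul g (mxvec_index c e) (mxvec_index a b) = (a == c)%:R * g e b.
Proof.
have -> : rmul g (mxvec_index c e) (mxvec_index a b) =
   ((delta_mx 0 (mxvec_index c e) : 'rV_(d * d)) *m rmul g) 0 (mxvec_index a b) by rewrite -rowE [RHS]mxE.
rewrite -mxvec_delta mul_vec_lin mxvecE mxE (bigD1 e) //= big1 ?addr0.
  by rewrite mxE eqxx andbT.
by move=> i /negbTE ne; rewrite mxE ne andbF mul0r.
Qed.

Lemma lin_mulmx_tr (g : 'M[rat]_d) : lmul g^T = (lmul g)^T.
Proof.
apply/matrixP=> p q; case/mxvec_indexP: p => c e; case/mxvec_indexP: q => a b.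
by rewrite [RHS]mxE !lin_mulmxE mxE eq_sym.
Qed.

(** Transposition conjugates right multiplication by [g] into left multiplication by its transpose,
    whose matrix is the transpose of [lmul g]. *)
Lemma det_lin_mulmxr (g : 'M[rat]_d) : \det (rmul g) = \det (lmul g).
Proof.
pose tau := lin_mx (@trmx rat d d).
have tau2 : tau *m tau = 1%:M.
  rewrite (lin_mx_mul (k := idfun)); last by move=> A; rewrite /= trmxK.
  exact: lin_mx_id.
have -> : rmul g = tau *m lmul g^T *m tau.
  rewrite -mulmxA (lin_mx_mul (f := mulmx g^T) (k := trmx \o mulmx g^T)) //.
  by rewrite (lin_mx_mul (k := mulmxr g)) // => A /=; rewrite trmx_mul !trmxK.
rewrite !det_mulmx lin_mulmx_tr det_tr mulrC mulrA -det_mulmx tau2 det1 mul1r //.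
Qed.

Lemma det_lin_mulmx_neq0 (g : 'M[rat]_d) : g \in unitmx -> \det (lmul g) != 0.
Proof.
move=> ug; have : lmul g *m lmul (invmx g) = 1%:M.
  rewrite (lin_mx_mul (k := idfun)); last by move=> A; rewrite /= mulKmx.
  exact: lin_mx_id.
move/(congr1 determinant); rewrite det_mulmx det1 => E.
by apply/eqP=> z; move/eqP: E; rewrite z mul0r eq_sym oner_eq0.
Qed.

Local Notation gmx g := (map_mx iota g).

(** The transpose appears because [lin_mx] acts on row vectors, whereas here the rows index the new
    entries. *)
Lemma gen_mulmx_l (g : 'M[rat]_d) a b :
  (gmx g * X) a b = \sum_q iota ((lmul g)^T (mxvec_index a b) q) * xi q.
Proof.
rewrite -mulmxE mxE (reindex _ (curry_mxvec_bij _ _)) /=.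
transitivity (\sum_c \sum_e
  iota ((lmul g)^T (mxvec_index a b) (mxvec_index c e)) * xi (mxvec_index c e));
  last by rewrite pair_bigA; apply: eq_bigr => -[].
apply: eq_bigr => c _; rewrite (bigD1 b) //= big1 ?addr0.
  by rewrite [_^T _ _]mxE lin_mulmxE eqxx mulr1 !mxE.
by move=> e ne; rewrite [_^T _ _]mxE lin_mulmxE eq_sym (negbTE ne) mulr0 rmorph0 mul0r.
Qed.

Lemma gen_mulmx_r (g : 'M[rat]_d) a b :
  (X * gmx g) a b = \sum_q iota ((rmul g)^T (mxvec_index a b) q) * xi q.
Proof.
rewrite -mulmxE mxE (reindex _ (curry_mxvec_bij _ _)) /=.
transitivity (\sum_c \sum_e
  iota ((rmul g)^T (mxvec_index a b) (mxvec_index c e)) * xi (mxvec_index c e));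
  last by rewrite pair_bigA; apply: eq_bigr => -[].
rewrite exchange_big; apply: eq_bigr => e _; rewrite (bigD1 a) //= big1 ?addr0.
  by rewrite [_^T _ _]mxE lin_mulmxrE eqxx mul1r gr_scalC !mxE.
by move=> c ne; rewrite [_^T _ _]mxE lin_mulmxrE eq_sym (negbTE ne) mul0r rmorph0 mul0r.
Qed.

Lemma prod_scal_mulmx N (g : 'M[rat]_d) (A : 'I_N -> 'M[G]_d) (x z : {ffun 'I_N -> 'I_d}) :
  \prod_j (gmx g * A j) (x j) (z j) =
  \sum_(y : {ffun 'I_N -> 'I_d}) iota (\prod_j g (x j) (y j)) * \prod_j A j (y j) (z j).
Proof.
under eq_bigr do rewrite -mulmxE mxE; rewrite bigA_distr_bigA; apply: eq_bigr => y _.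
by rewrite -scal_prod; apply: eq_bigr => j _; rewrite mxE.
Qed.

Lemma prod_mulmx_scal N (g : 'M[rat]_d) (A : 'I_N -> 'M[G]_d) (x z : {ffun 'I_N -> 'I_d}) :
  \prod_j (A j * gmx g) (x j) (z j) =
  \sum_(y : {ffun 'I_N -> 'I_d}) iota (\prod_j g (y j) (z j)) * \prod_j A j (x j) (y j).
Proof.
under eq_bigr do rewrite -mulmxE mxE; rewrite bigA_distr_bigA; apply: eq_bigr => y _.
by rewrite -scal_prod; apply: eq_bigr => j _; rewrite mxE gr_scalC.
Qed.

Variables (N : nat) (h : 'I_N -> nat).
Hypothesis sum_h : (\sum_i h i = M)%N.
Implicit Types x y z : {ffun 'I_N -> 'I_d}.

Definition entry_tensor x y : rat := phi (\prod_(j < N) (X ^+ h j) (x j) (y j)).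

Lemma entry_tensor_change (L : 'M[rat]_M) (Y : 'M[G]_d) x y :
  (forall a b, Y a b = \sum_q iota (L (mxvec_index a b) q) * xi q) ->
  phi (\prod_(j < N) (Y ^+ h j) (x j) (y j)) = \det L * entry_tensor x y.
Proof.
move=> YE; rewrite /entry_tensor !(entry_prod_ord _ h (fun j => (x j, y j))).
apply: berezin_entry_change => //; rewrite ?size_map //.
by rewrite sumnE big_map big_enum.
Qed.

(* [(g X)^h g = g (X g)^h], and [X |-> g X], [X |-> X g] have the same determinant. *)
Lemma entry_tensor_comm_unit (g : 'M[rat]_d) x z : g \in unitmx ->
  \sum_(y : {ffun 'I_N -> 'I_d}) (\prod_i g (x i) (y i)) * entry_tensor y z =
  \sum_(y : {ffun 'I_N -> 'I_d}) (\prod_i g (y i) (z i)) * entry_tensor x y.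
Proof.
move=> ug; apply: (mulfI (det_lin_mulmx_neq0 ug)).
have E : \prod_j (gmx g * (X * gmx g) ^+ h j) (x j) (z j) =
   \prod_j ((gmx g * X) ^+ h j * gmx g) (x j) (z j).
  apply: eq_bigr => j _; congr (fun_of_matrix _ _ _); elim: (h j) => [|k IH].
    by rewrite !expr0 mul1r mulr1.
  by rewrite exprSr mulrA IH exprSr -!mulrA.
move/(congr1 phi): E; rewrite prod_scal_mulmx prod_mulmx_scal !raddf_sum !big_distrr /=.
have El y : phi (iota (\prod_i g (x i) (y i)) * \prod_j ((X * gmx g) ^+ h j) (y j) (z j)) =
    \det (lmul g) * ((\prod_i g (x i) (y i)) * entry_tensor y z).
  rewrite berezinZ (entry_tensor_change _ _ (gen_mulmx_r g)) det_tr det_lin_mulmxr.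
  by rewrite mulrCA.
have Er y : phi (iota (\prod_i g (y i) (z i)) * \prod_j ((gmx g * X) ^+ h j) (x j) (y j)) =
    \det (lmul g) * ((\prod_i g (y i) (z i)) * entry_tensor x y).
  rewrite berezinZ (entry_tensor_change _ _ (gen_mulmx_l g)) det_tr.
  by rewrite mulrCA.
under eq_bigr do rewrite El; move=> ->.
by apply: eq_bigr => y _; rewrite Er.
Qed.

(* Polarizing [g^{(x) N}] at [g = t + sum_(j in S) E_j] extracts the symmetrized tensor
   product of elementary matrices; the shift [t] only serves to make every [g] invertible. *)
Lemma entry_tensor_comm b c x z :
  \sum_(s | reidx s b == x) entry_tensor (reidx s c) z =
  \sum_(s | reidx s c == z) entry_tensor x (reidx s b).
Proof.
pose E j : 'M[rat]_d := delta_mx (b j) (c j).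
have [t ut] := shift_unit (fun S : {set 'I_N} => \sum_(j in S) E j).
have gE S p q : (t%:M + \sum_(j in S) E j) p q = (t%:M : 'M_d) p q + \sum_(j in S) E j p q.
  by rewrite mxE summxE.
(* The product of the entries of the [E (s i)] at [(p i, q i)] is 1 exactly when [s] carries [b] to
   [p] and [c] to [q], and 0 otherwise. *)
have symE p q : \sum_(S : {set 'I_N}) (-1) ^+ #|~: S| *
     \prod_i (t%:M + \sum_(j in S) E j) (p i : 'I_d) (q i) =
   \sum_(s : 'S_N) ((reidx s b == finfun p) && (reidx s c == finfun q))%:R.
  transitivity (\sum_(s : 'S_N) \prod_i E (s i) (p i) (q i)).
    rewrite -(polarization (fun i => (t%:M : 'M_d) (p i) (q i)) (fun j i => E j (p i) (q i))).
    by apply: eq_bigr => S _; congr (_ * _); apply: eq_bigr => i _; rewrite gE.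
  apply: eq_bigr => s _; have [/andP [/eqP/ffunP pE /eqP/ffunP qE]|ne] := boolP (_ && _).
    apply: big1 => i _; have := pE i; have := qE i; rewrite !ffunE mxE.
    by move=> -> ->; rewrite !eqxx.
  have /existsP [i ni] : [exists i, ~~ ((p i == b (s i)) && (q i == c (s i)))].
    apply: contraNT ne => /existsPn H; apply/andP; split; apply/eqP/ffunP=> i;
    by rewrite !ffunE; have := H i; rewrite negbK => /andP [/eqP ? /eqP ?]. 
  by rewrite (bigD1 i) //= mxE (negbTE ni) mul0r.
have eqS : \sum_(S : {set 'I_N}) (-1) ^+ #|~: S| *
    \sum_(y : {ffun 'I_N -> 'I_d}) (\prod_i (t%:M + \sum_(j in S) E j) (x i) (y i)) * entry_tensor y z =
  \sum_(S : {set 'I_N}) (-1) ^+ #|~: S| *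
    \sum_(y : {ffun 'I_N -> 'I_d}) (\prod_i (t%:M + \sum_(j in S) E j) (y i) (z i)) * entry_tensor x y.
  by apply: eq_bigr => S _; rewrite entry_tensor_comm_unit.
have finE (f : {ffun 'I_N -> 'I_d}) : finfun f = f by apply/ffunP=> i; rewrite ffunE.
have symF (p q : {ffun 'I_N -> 'I_d}) := symE p q.
transitivity (\sum_(y : {ffun 'I_N -> 'I_d}) (\sum_(s : 'S_N) ((reidx s b == x) && (reidx s c == y))%:R) * entry_tensor y z).
  under [RHS]eq_bigr do rewrite big_distrl /=.
  rewrite [RHS]exchange_big [LHS]big_mkcond; apply: eq_bigr => s _ /=.
  rewrite (bigD1 (reidx s c)) //= eqxx andbT big1 ?addr0; first by case: eqP; rewrite ?mul1r ?mul0r.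
  by move=> y ne; rewrite [reidx s c == y]eq_sym (negbTE ne) andbF mul0r.
transitivity (\sum_(y : {ffun 'I_N -> 'I_d}) (\sum_(s : 'S_N) ((reidx s b == y) && (reidx s c == z))%:R) * entry_tensor x y); last first.
  under eq_bigr do rewrite big_distrl /=.
  rewrite exchange_big [RHS]big_mkcond; apply: eq_bigr => s _ /=.
  rewrite (bigD1 (reidx s b)) //= eqxx /= big1 ?addr0; first by case: eqP; rewrite ?mul1r ?mul0r.
  by move=> y ne; rewrite [reidx s b == y]eq_sym (negbTE ne) mul0r.
transitivity (\sum_(S : {set 'I_N}) (-1) ^+ #|~: S| *
    \sum_(y : {ffun 'I_N -> 'I_d}) (\prod_i (t%:M + \sum_(j in S) E j) (x i) (y i)) * entry_tensor y z).
  under [RHS]eq_bigr do rewrite big_distrr.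
  rewrite exchange_big; apply: eq_bigr => y _; have := symF x y; rewrite !finE => <-; rewrite big_distrl.
  by apply: eq_bigr => S _ /=; rewrite mulrA.
rewrite eqS; under eq_bigr do rewrite big_distrr.
rewrite exchange_big; apply: eq_bigr => y _; have := symF y z; rewrite !finE => <-; rewrite big_distrl.
by apply: eq_bigr => S _ /=; rewrite mulrA.
Qed.

Lemma entry_tensor_eq0 :
  (forall s, phi (perm_trace G h s) = 0) -> forall x y, entry_tensor x y = 0.
Proof.
move=> tr0; apply: commutant_eq0; first exact: entry_tensor_comm.
move=> s; rewrite -[RHS](tr0 s) /perm_trace raddf_sum; apply: eq_bigr => a _.
by congr (phi _); apply: eq_bigr => j _; rewrite ffunE.
Qed.

End Invariance.

(** * Tensor identities and the generic matrix *)

Section Evaluation.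
Variables (d : nat) (G : grassmann (d * d)).
Hypothesis d_gt0 : (0 < d)%N.
Local Notation I := ('I_d * 'I_d)%type.
Local Notation xi := (gr_gen G).
Local Notation phi := (@berezin _ G).
Local Notation X := (generic_mx G).
Local Notation M := (d * d)%N.

Let e0 : I := (Ordinal d_gt0, Ordinal d_gt0).

Definition letter (e : I) : 'I_M := mxvec_index e.1 e.2.

Lemma letter_inj : injective letter.
Proof.
have [g gK _] := curry_mxvec_bij d d.
by apply: (can_inj (g := g)) => -[a b]; exact: (gK (a, b)).
Qed.

Lemma block_eval_prod (R : pzRingType) (Z : nat -> 'M[R]_d) lam (e : 'I_(size lam) -> I) :
  \prod_(j < size lam) (\big[mulmx/1%:M]_(sumn (take j lam) <= i < sumn (take j.+1 lam)) Z i)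
     (e j).1 (e j).2 =
  blocks lam [seq e j | j <- enum 'I_(size lam)] Z.
Proof.
elim: lam Z e => [|h lam IH] Z e; first by rewrite big_ord0 enum_ord0.
rewrite big_ord_recl enum_ordSl /= take0 addn0; congr (_ * _).
rewrite -map_comp -IH; apply: eq_bigr => j _ /=; congr (fun_of_matrix _ _ _).
rewrite /bump add1n /= -[(h + sumn (take j lam))%N]addnC big_addn [(h + _)%N]addnC addnK.
by apply: eq_bigr => i _; rewrite addnC.
Qed.

Variables (F : fieldType) (lam : seq nat).
Hypothesis pchar0 : [pchar F] =i pred0.
Local Notation k := (sumn lam).
Implicit Types (u : {ffun 'I_k -> I}) (t : 'S_k).

Definition word_fun (w : seq I) : {ffun 'I_k -> I} := [ffun i => nth e0 w (val i)].

Lemma ST_eval_words (A : nat -> 'M[F]_d) (e : 'I_(size lam) -> I) :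
  ST_eval A e = \sum_(t : 'S_k) (-1) ^+ t * \sum_(w <- words lam [seq e j | j <- enum 'I_(size lam)])
    \prod_(i < k) A (t i) (word_fun w i).1 (word_fun w i).2.
Proof.
apply: eq_bigr => t _; congr (_ * _).
rewrite (block_eval_prod (fun i => A (permn t i)) e) (blocksE _ e0);
  last by rewrite size_map size_enum_ord.
apply: eq_bigr => w _; apply: eq_bigr => i _; rewrite !ffunE.
by rewrite /permn valK.
Qed.

(** The coefficient in [ST_eval] of the monomial taking entry [u i] of the matrix [A i]. Being an
    integer, it links evaluations over [F] with the rational Grassmann algebra. *)
Definition alt_count (es : seq I) u : int :=
  \sum_(w <- words lam es) \sum_(t : 'S_k) (-1) ^+ t * (reidx t u == word_fun w)%:R.

Lemma alt_countE (R : pzRingType) es u :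
  (alt_count es u)%:~R =
  \sum_(w <- words lam es) \sum_(t : 'S_k) (-1) ^+ t * (reidx t u == word_fun w)%:R :> R.
Proof.
rewrite rmorph_sum; apply: eq_bigr => w _; rewrite rmorph_sum; apply: eq_bigr => t _.
by rewrite rmorphM rmorph_sign rmorph_nat.
Qed.

Lemma prod_delta (f g : 'I_k -> I) :
  \prod_i (f i == g i)%:R = (finfun f == finfun g)%:R :> F.
Proof.
have [E|ne] := eqVneq (finfun f) (finfun g).
  by apply: big1 => i _; have /ffunP/(_ i) := E; rewrite !ffunE => ->; rewrite eqxx.
have /existsP [i ni] : [exists i, f i != g i].
  by apply: contraNT ne => /existsPn H; apply/eqP/ffunP=> i; rewrite !ffunE; apply/eqP/negPn.
by rewrite (bigD1 i) //= (negbTE ni) mul0r.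
Qed.

Lemma ST_eval_alt_count (A : nat -> 'M[F]_d) (e : 'I_(size lam) -> I) :
  ST_eval A e = \sum_(u : {ffun 'I_k -> I}) (\prod_(i < k) A i (u i).1 (u i).2) *
    (alt_count [seq e j | j <- enum 'I_(size lam)] u)%:~R.
Proof.
rewrite ST_eval_words.
under [RHS]eq_bigr => u _ do rewrite alt_countE big_distrr.
rewrite [RHS]exchange_big /=.
under [LHS]eq_bigr do rewrite big_distrr.
rewrite [LHS]exchange_big; apply: eq_bigr => w _ /=.
under [RHS]eq_bigr do rewrite big_distrr.
rewrite [RHS]exchange_big; apply: eq_bigr => t _ /=.
rewrite (bigD1 (reidx t^-1%g (word_fun w))) //= reidxKV eqxx mulr1 [X in _ = _ + X]big1 ?addr0.
  rewrite mulrC; congr (_ * _); rewrite [RHS](reindex_inj (@perm_inj _ t)) /=.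
  by apply: eq_bigr => i _; rewrite [reidx _ _ _]ffunE permK.
move=> u ne; case: eqP => [E|]; last by rewrite !mulr0.
by move: ne; rewrite -E reidxK eqxx.
Qed.

Definition unit_eval u (n : nat) : 'M[F]_d :=
  if insub n is Some i then delta_mx (u i).1 (u i).2 else 0.

(** Elementary matrices isolate a single coefficient; for an identity over a field of characteristic
    0, all coefficients are therefore zero integers. *)
Lemma ST_eval_unit u (e : 'I_(size lam) -> I) :
  ST_eval (unit_eval u) e = (alt_count [seq e j | j <- enum 'I_(size lam)] u)%:~R.
Proof.
rewrite ST_eval_alt_count (bigD1 u) //= [X in _ + X]big1 ?addr0.
  rewrite big1 ?mul1r // => i _; rewrite /unit_eval valK mxE !eqxx //.
move=> v ne; suff -> : \prod_(i < k) unit_eval u i (v i).1 (v i).2 = 0 by rewrite mul0r.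
transitivity (\prod_(i < k) (v i == u i)%:R : F).
  by apply: eq_bigr => i _; rewrite /unit_eval valK mxE.
rewrite prod_delta; have fE (f : {ffun 'I_k -> I}) : finfun f = f by apply/ffunP=> i; rewrite ffunE.
by rewrite !fE (negbTE ne).
Qed.

Lemma intr_eq0_pchar0 (z : int) : z%:~R = 0 :> F -> z = 0.
Proof.
have nat0 n : n%:R = 0 :> F -> n = 0%N.
  by move/eqP; rewrite ((pcharf0P F).1 pchar0) => /eqP.
case: z => n; first by rewrite -pmulrn => /nat0 ->.
by rewrite NegzE rmorphN /= -pmulrn => /eqP; rewrite oppr_eq0 => /eqP /nat0.
Qed.

(** An alternating function of the word [u], with [y] supplying the letters that complete it to top
    degree. *)
Definition alt_val (y : G) u : rat := phi (\prod_i xi (letter (u i)) * y).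

Lemma alt_val_perm y u t : alt_val y (reidx t u) = (-1) ^+ t * alt_val y u.
Proof.
rewrite /alt_val -berezin_sign mulrA -(gen_word_perm G (fun i => letter (u i))).
by congr (phi (_ * _)); apply: eq_bigr => i _; rewrite ffunE.
Qed.

Lemma berezin_entry_prod es y : size es = size lam ->
  phi (entry_prod X lam es * y) = \sum_(w <- words lam es) alt_val y (word_fun w).
Proof.
move=> ss; rewrite (entry_prodE _ e0) // big_distrl raddf_sum /=; apply: eq_bigr => w _.
by congr (phi (_ * _)); apply: eq_bigr => i _; rewrite mxE ffunE.
Qed.

(* Both sides of [k! sum_w alpha(w) = sum_u alpha(u) alt_count(u)] for an alternating [alpha]. *)
Lemma TPI_entry_prod es y : is_TPI F d lam -> size es = size lam ->
  phi (entry_prod X lam es * y) = 0.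
Proof.
move=> tpi ss; rewrite berezin_entry_prod //.
have c0 u : alt_count es u = 0.
  apply: intr_eq0_pchar0; rewrite -[RHS](tpi (unit_eval u) (fun j => nth e0 es j)).
  rewrite ST_eval_unit; congr (alt_count _ _)%:~R.
  rewrite (map_comp (nth e0 es) val) val_enum_ord -ss.
  by rewrite -[LHS](mkseq_nth e0).
have : \sum_(u : {ffun 'I_k -> I}) alt_val y u * (alt_count es u)%:~R = 0.
  by rewrite big1 // => u _; rewrite c0 mulr0.
under eq_bigr do rewrite alt_countE big_distrr.
rewrite exchange_big (eq_bigr (fun w => alt_val y (word_fun w) *+ #|{perm 'I_k}|)) /=.
  rewrite sumrMnl => /eqP; rewrite mulrn_eq0 => /orP [|/eqP //].
  by rewrite eqn0Ngt (_ : (0 < _)%N) //; apply/card_gt0P; exists 1%g.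
move=> w _; under eq_bigr do rewrite big_distrr.
rewrite exchange_big -sumr_const; apply: eq_bigr => t _ /=.
rewrite (bigD1 (reidx t^-1%g (word_fun w))) //= reidxKV eqxx mulr1 big1 ?addr0.
  by rewrite mulrC -alt_val_perm reidxKV.
move=> u ne; case: eqP => [E|]; last by rewrite !mulr0.
by move: ne; rewrite -E reidxK eqxx.
Qed.

Lemma gen_seq_uniq (s : seq 'I_M) : \prod_(p <- s) xi p != 0 -> uniq s.
Proof.
case: s => // p0 s'; set s := p0 :: s'; apply: contraNT => /(uniqPn p0) [i [j [lt_ij lt_j E]]].
rewrite (big_nth p0) big_mkord; apply/eqP.
have lt_i := ltn_trans lt_ij lt_j.
apply: (@gen_word_eq0 _ G _ (fun i : 'I_(size s) => nth p0 s i) (Ordinal lt_i) (Ordinal lt_j)) => //.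
by rewrite -val_eqE /= (ltn_eqF lt_ij).
Qed.

Lemma berezin_seq (s : seq 'I_M) : uniq s -> size s = M -> phi (\prod_(p <- s) xi p) != 0.
Proof.
move=> us sM; have M_gt0 : (0 < M)%N by rewrite muln_gt0 d_gt0.
pose p0 := Ordinal M_gt0.
rewrite (big_nth p0) big_mkord sM.
have inj : injective (fun i : 'I_M => nth p0 s i).
  by move=> i j /eqP; rewrite nth_uniq ?sM // => /eqP /val_inj.
have -> : \prod_(i < M) xi (nth p0 s i) = \prod_i xi (perm inj i).
  by apply: eq_bigr => i _; rewrite permE.
by rewrite berezin_perm signr_eq0.
Qed.

Lemma alt_count_not_inj es u : ~~ injectiveb u -> alt_count es u = 0.
Proof.
case/injectivePn => i [j ne eq_u]; apply: big1 => w _.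
have eqN (z : int) : z = - z -> z = 0 by lia.
apply: eqN; rewrite {1}(reindex_inj (mulIg (tperm i j))) -sumrN; apply: eq_bigr => t _.
rewrite odd_permM odd_tperm ne addbT signrN mulNr -reidxM; congr (- (_ * (_ == _)%:R)).
congr (reidx t _); apply/ffunP=> p; rewrite ffunE.
by case: tpermP => [->|->|].
Qed.

(* For injective [u], pairing with the complementary word [v] isolates the coefficient of [u]. *)
Lemma entry_prod_TPI :
  (forall es v, size es = size lam -> (k <= M)%N -> size v = (M - k)%N ->
     phi (entry_prod X lam es * \prod_(e <- v) X e.1 e.2) = 0) ->
  is_TPI F d lam.
Proof.
move=> kill A e; rewrite ST_eval_alt_count big1 // => u _.
set es := map _ _; have ss : size es = size lam by rewrite size_map size_enum_ord.
suff -> : alt_count es u = 0 by rewrite mulr0.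
have [ui|] := boolP (injectiveb u); last exact: alt_count_not_inj.
move/injectiveP: ui => ui.
(* The letters absent from [u]: against them, only rearrangements of [u] have a nonzero value. *)
pose v := [seq x <- enum [set: I] | x \notin codom u].
have vE x : (x \in v) = (x \notin codom u) by rewrite mem_filter mem_enum inE andbT.
have cardI : #|[set: I]| = M by rewrite cardsT card_prod !card_ord.
have sizev : (size v + k)%N = M.
  rewrite -cardI cardE -(count_predC [in codom u] (enum [set: I])) addnC; congr (_ + _)%N;
    last by rewrite size_filter.
  rewrite -size_filter -[LHS](card_ord k) -(size_codom u); apply/perm_size/uniq_perm.
  - by apply/injectiveP.
  - by rewrite filter_uniq ?enum_uniq.
  - by move=> x; rewrite mem_filter mem_enum !inE andbT.
have yE : \prod_(x <- v) X x.1 x.2 = \prod_(x <- v) xi (letter x).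
  by apply: eq_bigr => x _; rewrite mxE.
pose y := \prod_(x <- v) X x.1 x.2.
have wordE (w : {ffun 'I_k -> I}) :
    \prod_i xi (letter (w i)) * y = \prod_(p <- map letter (codom w ++ v)) xi p.
  by rewrite map_cat big_cat codomE !big_map /y yE.
have word_inj (w : {ffun 'I_k -> I}) : alt_val y w != 0 -> exists t, w = reidx t u.
  move=> nz; have : uniq (map letter (codom w ++ v)).
    by apply: gen_seq_uniq; apply: contraNneq nz => z; rewrite /alt_val wordE z raddf0.
  rewrite (map_inj_uniq letter_inj) cat_uniq => /and3P [wi dis _].
  have wu i : exists j, u j == w i.
    have : w i \in codom u.
      apply: contraNT dis => nin; apply/hasP; exists (w i); rewrite ?vE //=.
      exact: codom_f.
    by case/codomP => j ->; exists j.
  pose f i := xchoose (wu i); have fE i : u (f i) = w i by apply/eqP/(xchooseP (wu i)).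
  have fi : injective f.
    by move=> i j E; apply: (injectiveP _ wi); rewrite -!fE E.
  by exists (perm fi); apply/ffunP=> i; rewrite ffunE permE fE.
have au : alt_val y u != 0.
  rewrite /alt_val wordE; apply: berezin_seq.
    rewrite (map_inj_uniq letter_inj) cat_uniq; apply/and3P; split.
    - exact/injectiveP.
    - by apply/hasPn=> x; rewrite vE.
    - by rewrite filter_uniq ?enum_uniq.
  by rewrite size_map size_cat size_codom card_ord addnC.
have : alt_val y u * (alt_count es u)%:~R = 0.
  have kM : (k <= M)%N by rewrite -sizev leq_addl.
  rewrite alt_countE -[RHS](kill es v ss kM) ?berezin_entry_prod // -/y; last by rewrite -sizev addnK.
  rewrite big_distrr; apply: eq_bigr => w _ /=.
  (* By [au] a word of value 0 is no rearrangement of [u]; any other word is one, by a unique [t]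
     since [u] is injective. *)
  have [z|/word_inj [t ->]] := eqVneq (alt_val y (word_fun w)) 0.
    rewrite z big1 ?mulr0 // => t _; case: eqP => [E|]; last by rewrite mulr0.
    by move/eqP: z; rewrite -E alt_val_perm mulf_eq0 signr_eq0 (negbTE au).
  rewrite (bigD1 t) //= eqxx mulr1 big1 ?addr0; first by rewrite alt_val_perm mulrC.
  move=> s ne; case: eqP => [E|]; last by rewrite mulr0.
  case/eqP: ne; apply/permP=> i; apply: ui.
  by have /ffunP/(_ i) := E; rewrite !ffunE.
by move/eqP; rewrite mulf_eq0 (negbTE au) intr_eq0 => /eqP.
Qed.

End Evaluation.

(** * Packing into bins *)

(** The list is already non-increasing; for [m = 1] the part [m.-1] is 0 and is dropped. *)
Lemma poplusE m r : (0 < m)%N ->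
  poplus (ppow m r) [:: m.-1] = nseq r m ++ (if (1 < m)%N then [:: m.-1] else [::]).
Proof.
move=> m_gt0; rewrite /poplus /ppow filter_cat (all_filterP _) ?all_nseq ?m_gt0 ?orbT //.
have -> : [seq x <- [:: m.-1] | (0 < x)%N] = if (1 < m)%N then [:: m.-1] else [::].
  by rewrite /= -subn1 subn_gt0.
set ext := if _ then _ else _.
apply: sorted_sort; first by move=> a b c /= H1 H2; exact: leq_trans H2 H1.
have ext_sorted : path (fun a b : nat => (b <= a)%N) m ext.
  by rewrite /ext; case: ifP => //= _; rewrite leq_pred.
case: r => [|r] /=; first by move: ext_sorted; rewrite /ext; case: ifP.
by elim: r => [|r IH] //=; rewrite leqnn.
Qed.

Lemma bracketE d m : bracket d m = (\sum_(i <- iota 0 d) i.*2.+1 %/ m)%N.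
Proof.
rewrite /bracket big_add1 /= /index_iota subn0; apply: eq_bigr => i _.
by congr (_ %/ _)%N; lia.
Qed.

Lemma count_mul_sumn m (b : seq nat) : (count_mem m b * m <= sumn b)%N.
Proof. by elim: b => //= x b IH; rewrite mulnDl leq_add //; case: eqP => [->|] /=; lia. Qed.

(* Each bin [2 i + 1] holds at most [(2 i + 1) %/ m] parts [m]; since all [r] of them are
   placed, every bin is full, and the one receiving [m - 1] has remainder [m - 1]. *)
Lemma bins_remainder m r k d (B : seq (seq nat)) : (1 < m)%N ->
  r = (\sum_(i <- iota 0 d) i.*2.+1 %/ m)%N ->
  perm_eq (flatten B) (nseq r m ++ m.-1 :: nseq k 1%N) ->
  perm_eq (map sumn B) [seq i.*2.+1 | i <- iota 0 d] ->
  exists2 i, (i < d)%N & (m %| i.+1.*2)%N.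
Proof.
move=> m_gt1 rE pB pS.
have m_gt0 : (0 < m)%N by apply: ltnW.
have cle b : (count_mem m b <= sumn b %/ m)%N by rewrite leq_divRL // count_mul_sumn.
have sum_cnt : (\sum_(b <- B) count_mem m b = r)%N.
  have /seq.permP/(_ (pred1 m)) := pB; rewrite count_flatten sumnE big_map => ->.
  rewrite count_cat /= !count_nseq /= eqxx mul1n.
  rewrite (_ : (m.-1 == m) = false); last by lia.
  by rewrite (_ : (1 == m)%N = false) ?mul0n ?addn0 //; lia.
have sum_div : (\sum_(b <- B) sumn b %/ m = r)%N.
  by rewrite -(big_map sumn predT (fun c => c %/ m)%N) /= (perm_big _ pS) /= big_map rE.
have /flattenP [b bB mb] : m.-1 \in flatten B.
  by rewrite (perm_mem pB) mem_cat mem_head orbT.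
(* The bounds [cle] add up to an equality, so each of them is an equality. *)
have cb : (sumn b %/ m <= count_mem m b)%N.
  case/splitPr: B / bB sum_cnt sum_div {pB pS} => B1 B2.
  rewrite !big_cat !big_cons /=.
  have le1 := @leq_sum _ B1 predT _ _ (fun b _ => cle b).
  have le2 := @leq_sum _ B2 predT _ _ (fun b _ => cle b).
  by move: le1 le2 => /=; lia.
have sb : (count_mem m b * m + m.-1 <= sumn b)%N.
  rewrite (seq.permP (perm_to_rem mb)) (perm_sumn (perm_to_rem mb)) /=.
  rewrite (_ : (m.-1 == m) = false); last by lia.
  by rewrite add0n addnC leq_add2l count_mul_sumn.
have : sumn b \in [seq i.*2.+1 | i <- iota 0 d] by rewrite -(perm_mem pS) map_f.
case/mapP => i; rewrite mem_iota add0n => /= lt_i sE.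
exists i => //; rewrite doubleS -sE.
(* The remainder of [sumn b] modulo [m] is at least [m.-1], hence equal to it, and [m] divides
   [(sumn b).+1]. *)
have lt := ltn_pmod (sumn b) m_gt0; have dE := divn_eq (sumn b) m.
apply/dvdnP; exists (sumn b %/ m).+1; rewrite mulSn.
have : (sumn b %/ m * m <= count_mem m b * m)%N by rewrite leq_mul2r cb orbT.
lia.
Qed.

(** * Cutting products of traces into entries of powers *)

Section Decomposition.
Variables (d : nat) (G : grassmann (d * d)).
Local Notation X := (generic_mx G).
Local Notation T c := (\tr (X ^+ c)).

Lemma homog_sign p n (x : G) : homog p x -> homog p ((-1) ^+ n * x).
Proof.
move=> hx; rewrite -(addFb p); apply: homogM => //.
rewrite -signr_odd; case: (odd n); last exact: homog1.
by rewrite expr1 -(rmorphN1 (gr_scal G)); exact: homog_scal.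
Qed.

Lemma entry_prod_homog hs es : exists p, homog p (entry_prod X hs es).
Proof.
rewrite /entry_prod; exists (\big[addb/false]_(x <- zip hs es) odd x.1).
by apply: homog_prod => -[h e]; exact: generic_exp_homog.
Qed.

(** Sums of multiples of entry products with exponents [hs]. The cofactors are homogeneous so that
    they can be moved past another entry product, as [entry_spanM] requires. *)
Inductive entry_span (hs : seq nat) : G -> Prop :=
  | entry_span_gen es p y : size hs = size es -> homog p y ->
      entry_span hs (entry_prod X hs es * y)
  | entry_span0 : entry_span hs 0
  | entry_spanD x y : entry_span hs x -> entry_span hs y -> entry_span hs (x + y).

Lemma entry_span_sum hs (J : Type) (r : seq J) (E : J -> G) :
  (forall j, entry_span hs (E j)) -> entry_span hs (\sum_(j <- r) E j).
Proof.
move=> H; elim: r => [|j r IH]; first by rewrite big_nil; exact: entry_span0.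
by rewrite big_cons; apply: entry_spanD.
Qed.

Lemma entry_spanM hs hs' x x' :
  entry_span hs x -> entry_span hs' x' -> entry_span (hs ++ hs') (x * x').
Proof.
elim=> [es p y ss hy||x1 x2 _ IH1 _ IH2] hx'.
- elim: hx' => [es' p' y' ss' hy'||x1 x2 _ IH1 _ IH2].
  + have [q hq] := entry_prod_homog hs' es'.
    rewrite -mulrA [y * _]mulrA (supercomm hy hq) -!mulrA signr_mulCA.
    rewrite [_ * (_ * (y * y'))]mulrA -entry_prod_cat // -signr_mulCA.
    apply: (@entry_span_gen _ _ (p (+) p')); first by rewrite !size_cat ss ss'.
    by apply: homog_sign; exact: homogM.
  + by rewrite mulr0; exact: entry_span0.
  + by rewrite mulrDr; apply: entry_spanD.
- by rewrite mul0r; exact: entry_span0.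
- by rewrite mulrDl; apply: entry_spanD; [exact: IH1 | exact: IH2].
Qed.

Lemma entry_span_sign hs n x : entry_span hs x -> entry_span hs ((-1) ^+ n * x).
Proof.
elim=> [es p y ss hy||x1 x2 _ IH1 _ IH2].
- by rewrite -signr_mulCA; apply: entry_span_gen => //; apply: homog_sign; exact: hy.
- by rewrite mulr0; exact: entry_span0.
- by rewrite mulrDr; apply: entry_spanD.
Qed.

Lemma entry_span_exp h a b : entry_span [:: h] ((X ^+ h) a b).
Proof.
have := @entry_span_gen [:: h] [:: (a, b)] _ _ erefl (homog1 G).
by rewrite /entry_prod big_seq1 mulr1.
Qed.

Lemma entry_span_nil p x : homog p x -> entry_span [::] x.
Proof.
move=> hx; have := @entry_span_gen [::] [::] _ _ erefl hx.
by rewrite /entry_prod big_nil mul1r.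
Qed.

Lemma entry_span_expD hs q m r :
  (forall a b, entry_span hs ((X ^+ r) a b)) ->
  forall a b, entry_span (nseq q m ++ hs) ((X ^+ (q * m + r)) a b).
Proof.
move=> H; elim: q => [|q IH] a b //=.
rewrite mulSn -addnA exprD -mulmxE mxE; apply: entry_span_sum => c.
exact: (@entry_spanM [:: m] _ _ _ (entry_span_exp m a c) (IH c b)).
Qed.

Lemma entry_span_trace hs q m r :
  (forall a b, entry_span hs ((X ^+ r) a b)) ->
  entry_span (nseq q m ++ hs) (T (q * m + r)).
Proof. by move=> H; apply: entry_span_sum => i; apply: entry_span_expD. Qed.

Lemma entry_span_prod_trace m cs :
  entry_span (nseq (\sum_(c <- cs) c %/ m)%N m) (\prod_(c <- cs) T c).
Proof.
elim: cs => [|c cs IH]; first by rewrite !big_nil; apply: entry_span_nil; exact: homog1.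
rewrite !big_cons nseqD; apply: entry_spanM => //.
rewrite {2}(divn_eq c m) -[nseq _ _]cats0; apply: entry_span_trace => a b.
by apply: entry_span_nil; exact: generic_exp_homog.
Qed.

(** Each trace is cut into as many powers [X ^+ m] as fit. The trace of exponent [c0] is moved to
    the end, up to sign, where its remainder provides the last part [m.-1]. *)
Lemma entry_span_prod_trace_ext m c0 cs : (0 < m)%N -> c0 \in cs -> (c0 %% m = m.-1)%N ->
  entry_span (nseq (\sum_(c <- cs) c %/ m)%N m ++ (if (1 < m)%N then [:: m.-1] else [::]))
    (\prod_(c <- cs) T c).
Proof.
move=> m_gt0 c0in c0m; case/splitPr: cs / c0in => cs1 cs2.
rewrite !big_cat !big_cons /=.
have h2 := @homog_prod _ G _ cs2 odd _ (trace_homog G).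
rewrite (supercomm (trace_homog G c0) h2) signr_mulCA; apply: entry_span_sign.
rewrite [(c0 %/ m + _)%N]addnC !nseqD -!catA.
do 2 (apply: entry_spanM; first exact: entry_span_prod_trace).
rewrite {2}(divn_eq c0 m) c0m; apply: entry_span_trace => a b.
case: ifP => m1; first exact: entry_span_exp.
by apply: entry_span_nil; exact: generic_exp_homog.
Qed.

Lemma berezin_entry_span hs x :
  (forall es y, size es = size hs -> berezin (entry_prod X hs es * y) = 0) ->
  entry_span hs x -> berezin x = 0.
Proof.
move=> H; elim=> [es p y ss _||x1 x2 _ IH1 _ IH2]; first exact: H.
  exact: raddf0.
by rewrite raddfD /= IH1 IH2 addr0.
Qed.

(** With all exponents equal to 1 some entry of the tensor is nonzero, so by [entry_tensor_eq0] some
    contraction is nonzero too, and its bins are 1, 3, ..., 2d-1 in some order. *)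
Lemma prod_trace_odds_neq0 : (0 < d)%N -> exists2 cs : seq nat,
  perm_eq cs [seq i.*2.+1 | i <- iota 0 d] & berezin (\prod_(c <- cs) T c) != 0.
Proof.
move=> d_gt0; pose h (i : 'I_(d * d)) := 1%N.
have sum_h : (\sum_i h i = d * d)%N by rewrite sum_nat_const card_ord muln1.
have [g _ gK] := curry_mxvec_bij d d.
(* The slots run through all matrix positions in the order of the generators, which yields exactly
   the top product. *)
pose x := [ffun j : 'I_(d * d) => (g j).1]; pose y := [ffun j : 'I_(d * d) => (g j).2].
have xy : @entry_tensor d G _ h x y = 1.
  rewrite /entry_tensor -(berezin_top G); congr (berezin _); apply: eq_bigr => j _.
  rewrite expr1 mxE !ffunE; congr (gr_gen G _).
  by rewrite -[RHS](gK j) //; case: (g j).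
have [/existsP [s nz]|/existsPn z] := boolP [exists s, berezin (perm_trace G h s) != 0].
  have nz' : perm_trace G h s != 0 by apply: contraNneq nz => ->; rewrite raddf0.
  have [B [b [_ pS E]]] := perm_trace_bins (fun i => isT : (0 < h i)%N) sum_h nz'.
  exists (map sumn B) => //; apply: contraNneq nz => z.
  by rewrite E berezin_sign z mulr0.
have := entry_tensor_eq0 d_gt0 sum_h (fun s => eqP (negPn (z s))) x y.
by rewrite xy => /eqP; rewrite oner_eq0.
Qed.

End Decomposition.

(** * The two directions and the equivalence *)

Lemma entry_prod_nseq1 d (R : pzRingType) (Y : 'M[R]_d) n (v : seq ('I_d * 'I_d)) :
  size v = n -> entry_prod Y (nseq n 1%N) v = \prod_(e <- v) Y e.1 e.2.
Proof.
move=> <-; rewrite /entry_prod; elim: v => [|e v IH] /=; first by rewrite !big_nil.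
by rewrite !big_cons IH expr1.
Qed.

(** An identity would kill the whole [entry_span] of the partition, which contains the nonzero
    product of odd traces since bin [i.*2.+1] has room for [m.-1]. *)
Lemma not_TPI_of_dvdn (F : fieldType) d m i : [pchar F] =i pred0 -> (0 < d)%N -> (0 < m)%N ->
  (i < d)%N -> (i.*2.+1 %% m = m.-1)%N ->
  ~ is_TPI F d (poplus (ppow m (bracket d m)) [:: m.-1]).
Proof.
move=> F0 d_gt0 m_gt0 lt_i im; rewrite poplusE // bracketE; set lam := _ ++ _ => tpi.
have [G] := grassmann_exists (d * d).
have [cs pcs nz] := prod_trace_odds_neq0 G d_gt0.
move/eqP: nz; apply; apply: (@berezin_entry_span d G lam).
  by move=> es y ss; exact: (TPI_entry_prod d_gt0 F0 y tpi ss).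
have iin : i.*2.+1 \in cs by rewrite (perm_mem pcs); apply: map_f; rewrite mem_iota.
have := entry_span_prod_trace_ext G m_gt0 iin im.
by rewrite (perm_big _ pcs) /= big_map.
Qed.

Lemma TPI_of_odd_gt (F : fieldType) d m : [pchar F] =i pred0 -> (0 < d)%N ->
  odd m -> (d < m)%N -> is_TPI F d (poplus (ppow m (bracket d m)) [:: m.-1]).
Proof.
move=> F0 d_gt0 om lt_dm.
have m_gt1 : (1 < m)%N by lia.
have m_gt2 : (2 < m)%N by move: om m_gt1; case: m {lt_dm} => [|[|[|]]].
have [G] := grassmann_exists (d * d).
rewrite poplusE ?(ltnW m_gt1) // m_gt1.
set lam := _ ++ _; apply: (entry_prod_TPI (G := G) d_gt0) => es v ss kM sv.
(* The complementary single entries become parts equal to 1, bringing the total degree to d^2. *)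
pose hs := lam ++ nseq (d * d - sumn lam) 1%N; pose es' := es ++ v.
have ss' : size es' = size hs by rewrite /es' /hs [LHS]size_cat [RHS]size_cat ss sv size_nseq.
have sum_hs : sumn hs = (d * d)%N by rewrite sumn_cat sumn_nseq mul1n subnKC.
have pos_hs : all (fun x => 0 < x)%N hs.
  by rewrite !all_cat !all_nseq /= orbT !andbT; lia.
pose e0 := (Ordinal d_gt0, Ordinal d_gt0).
pose h (j : 'I_(size hs)) := nth 0%N hs j.
pose x := [ffun j : 'I_(size hs) => (nth e0 es' j).1].
pose y := [ffun j : 'I_(size hs) => (nth e0 es' j).2].
have hE : [seq h j | j <- enum 'I_(size hs)] = hs.
  rewrite (map_comp (nth 0%N hs) val) val_enum_ord; exact: mkseq_nth.
have sum_h : (\sum_i h i = d * d)%N.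
  by rewrite -sum_hs -[in RHS]hE sumnE big_map big_enum.
have pos_h i : (0 < h i)%N by apply: (allP pos_hs); exact: mem_nth.
rewrite -(entry_prod_nseq1 _ sv) -entry_prod_cat // -/hs -/es'.
have -> : entry_prod (generic_mx G) hs es' =
    \prod_(j < size hs) (generic_mx G ^+ h j) (x j) (y j).
  rewrite (entry_prod_ord _ h (fun j => (x j, y j))) hE; congr entry_prod.
  rewrite -[LHS](mkseq_nth e0) ss' /mkseq -val_enum_ord -map_comp.
  by apply: eq_map => j /=; rewrite !ffunE; case: nth.
apply: (entry_tensor_eq0 d_gt0 sum_h) => s.
have [->|nz] := eqVneq (perm_trace G h s) 0; first exact: raddf0.
have [B [b [pB pS _]]] := perm_trace_bins pos_h sum_h nz.
rewrite hE /hs /lam -catA /= in pB.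
have [i lt_i dvd] := bins_remainder m_gt1 (bracketE d m) pB pS.
(* An odd [m] dividing [i.+1.*2] divides [i.+1], which is at most [d], against [d < m]. *)
have : (m %| i.+1)%N by move: dvd; rewrite -muln2 Gauss_dvdl // coprimen2.
by move/dvdn_leq => /(_ isT); lia.
Qed.

Theorem mainTheorem11 (F : fieldType) (d m : nat) :
  [pchar F]%R =i pred0 -> (0 < d)%N -> (0 < m)%N -> (m <= 2 * d)%N ->
  (~ is_TPI F d (poplus (ppow m (bracket d m)) [:: m.-1])
   <-> (~~ odd m \/ (odd m /\ (m <= d)%N))).
Proof.
move=> F0 d_gt0 m_gt0 le_m2d; split=> [ntpi|].
  have [om|] := boolP (odd m); [right; split=> // | by left].
  by rewrite leqNgt; apply/negP=> lt_dm; apply: ntpi; exact: TPI_of_odd_gt.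
case=> [em|[om le_md]].
  (* For [m] even, [m.-1] is odd and exactly fills the bin of that size. *)
  apply: (@not_TPI_of_dvdn _ _ _ (m./2.-1)) => //; first by lia.
  have -> : (m./2.-1.*2.+1 = m.-1)%N by lia.
  by rewrite modn_small // prednK.
(* For [m] odd, the bin of size 2m-1 holds one part [m] and the part [m.-1]; it exists because
   [m <= d]. *)
apply: (@not_TPI_of_dvdn _ _ _ m.-1) => //; first by lia.
have -> : (m.-1.*2.+1 = m + m.-1)%N by lia.
by rewrite modnDl modn_small // prednK.
Qed.
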